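(* Let $X$ be a fibrewise well-pointed $H$-space over a path-connected, numerably categorical space $B$, with fibrewise multiplication $\mu$. Suppose that $X$ is weakly fibrant, and that there exists a point $b\in B$ such that the fibre $X_b=p_X^{-1}(\{b\})$ is a connected CW-complex. Then the fibrewise shearing map $sh:X\times_B X\to X\times_B X$, $sh(x,y)=(x,\mu(x,y))$, is a fibrewise pointed homotopy equivalence. Consequently, $X$ admits a fibrewise division map $\delta:X\times_B X\to X$.
   Context: Fix a topological space $B$ and let $I=[0,1]$. A fibrewise space over $B$ is a space $X$ with a continuous map $p_X:X\to B$; a fibrewise map $f:X\to Y$ is a continuous map with $p_Y\circ f=p_X$; a fibrewise homotopy is a homotopy $H:X\times I\to Y$ with $p_Y(H(x,t))=p_X(x)$ for all $x,t$; fibrewise homotopy equivalences are defined accordingly. A fibrewise pointed space is a fibrewise space $X$ with a section $s_X:B\to X$ of $p_X$; a fibrewise pointed map is a fibrewise map $f$ with $f\circ s_X=s_Y$; a fibrewise pointed homotopy ($\simeq^B_B$) is a fibrewise homotopy $H$ with $H(s_X(b),t)=s_Y(b)$ for all $b\in B$, $t\in I$; fibrewise pointed homotopy equivalences are defined accordingly. The fibrewise product $X\times_B X=\{(x,y)\in X\times X:p_X(x)=p_X(y)\}$ is fibrewise pointed with section $b\mapsto(s_X(b),s_X(b))$; $pr_1,pr_2$ are its projections. A fibrewise cofibration is a fibrewise map having the homotopy extension property with respect to all fibrewise homotopies into fibrewise spaces over $B$. A fibrewise pointed space $X$ is fibrewise well-pointed if $s_X:B\to X$ is a closed fibrewise cofibration.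 A fibrewise $H$-space is a fibrewise pointed space $X$ with a fibrewise pointed map $\mu:X\times_B X\to X$ such that $\mu\circ i_1\simeq^B_B id_X$ and $\mu\circ i_2\simeq^B_B id_X$, where $i_1=(id_X,s_X\circ p_X)$, $i_2=(s_X\circ p_X,id_X)$. A fibrewise division on $X$ is a fibrewise pointed map $\delta:X\times_B X\to X$ with $\mu\circ(pr_1,\delta)\simeq^B_B pr_2$. $B$ is numerably categorical if it has a numerable cover $\{V_j\}_{j\in J}$ (one admitting a subordinate locally finite partition of unity) such that each inclusion $V_j\hookrightarrow B$ is nullhomotopic. A weak fibration (Dold fibration) is a map $p:E\to B$ that is fibrewise homotopy equivalent over $B$ to a Hurewicz fibration over $B$; $X$ is weakly fibrant if $p_X:X\to B$ is a weak fibration. *)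

(* Defs.v *)
From HB Require Import structures.
From mathcomp Require Import all_boot all_order all_algebra.
From mathcomp Require Import all_classical all_reals all_analysis.
From mathcomp Require Import homotopy.

Set Implicit Arguments.
Unset Strict Implicit.
Unset Printing Implicit Defensive.
Import Order.TTheory GRing.Theory Num.Theory.
Import numFieldNormedType.Exports.
Local Open Scope classical_set_scope.
Local Open Scope ring_scope.

Definition unitI (R : realType) : Type := set_type (`[0%R, 1%R]%classic : set R).

Section UnitInterval.
Variable R : realType.

HB.instance Definition _ := Topological.on (unitI R).

Lemma unitI_mem0 : (0 : R) \in (`[0%R, 1%R]%classic : set R).
Proof. by rewrite mem_setE in_itv /= lexx ler01. Qed.

Lemma unitI_mem1 : (1 : R) \in (`[0%R, 1%R]%classic : set R).
Proof. by rewrite mem_setE in_itv /= lexx ler01. Qed.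

Lemma unitI_neq01 : (exist _ 0 unitI_mem0 : unitI R) != exist _ 1 unitI_mem1.
Proof. by apply/eqP => /(congr1 set_val) /esym/eqP; rewrite oner_eq0. Qed.

HB.instance Definition _ := @isBiPointed.Build (unitI R)
  (exist _ 0 unitI_mem0) (exist _ 1 unitI_mem1) unitI_neq01.

End UnitInterval.

Record fwSpace (B : topologicalType) := FwSpace {
  fw_space :> topologicalType;
  fw_proj : fw_space -> B;
  fw_proj_cts : continuous fw_proj }.

Record pfwSpace (B : topologicalType) := PfwSpace {
  pfw_space :> fwSpace B;
  pfw_sec : B -> pfw_space;
  pfw_sec_cts : continuous pfw_sec;
  pfw_secK : forall b, fw_proj (pfw_sec b) = b }.

Record fwMap (B : topologicalType) (X Y : fwSpace B) := FwMap {
  fw_fun :> X -> Y;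
  fw_fun_cts : continuous fw_fun;
  fw_fun_proj : forall x, fw_proj (fw_fun x) = fw_proj x }.

Record pfwMap (B : topologicalType) (X Y : pfwSpace B) := PfwMap {
  pfw_fun :> fwMap X Y;
  pfw_fun_sec : forall b, pfw_fun (pfw_sec X b) = pfw_sec Y b }.

Arguments fw_proj_cts {B} f : rename.
Arguments pfw_sec_cts {B} p : rename.
Arguments fw_fun_cts {B X Y} f : rename.

Section Constructions.
Variable B : topologicalType.

Definition fw_base : fwSpace B := FwSpace (fun b : B => @cvg_id _ (nbhs b)).

Definition fw_sec (X : pfwSpace B) : fwMap fw_base X :=
  @FwMap B fw_base X (@pfw_sec B X) (pfw_sec_cts X) (@pfw_secK B X).

Definition fibre (X : fwSpace B) (b : B) : topologicalType :=
  set_type (@fw_proj B X @^-1` [set b]).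

Lemma fw_cyl_cts (R : realType) (X : fwSpace B) :
  continuous (fun xt : X * unitI R => fw_proj xt.1).
Proof.
move=> xt; apply: continuous_comp; first exact: cvg_fst.
exact: fw_proj_cts.
Qed.

(* Fibrewise homotopies [X * I -> Y] are the fibrewise maps out of the
   cylinder [X * I], which lies over [B] via the first factor. *)
Definition fw_cyl (R : realType) (X : fwSpace B) : fwSpace B :=
  FwSpace (@fw_cyl_cts R X).

Section Maps.
Variables X Y Z : fwSpace B.

Definition fw_id : fwMap X X :=
  FwMap (fun x : X => @cvg_id _ (nbhs x)) (fun=> erefl).

Lemma fw_comp_cts (g : fwMap Y Z) (f : fwMap X Y) :
  continuous (fun x => g (f x)).
Proof. by move=> x; apply: continuous_comp; exact: fw_fun_cts. Qed.

Lemma fw_comp_proj (g : fwMap Y Z) (f : fwMap X Y) x :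
  fw_proj (g (f x)) = fw_proj x.
Proof. by rewrite !fw_fun_proj. Qed.

Definition fw_comp (g : fwMap Y Z) (f : fwMap X Y) : fwMap X Z :=
  FwMap (@fw_comp_cts g f) (fw_comp_proj g f).

End Maps.

Section PointedMaps.
Variables X Y Z : pfwSpace B.

Definition pfw_id : pfwMap X X := @PfwMap B X X (fw_id X) (fun=> erefl).

Lemma pfw_comp_sec (g : pfwMap Y Z) (f : pfwMap X Y) b :
  fw_comp g f (pfw_sec X b) = pfw_sec Z b.
Proof. by rewrite /= !pfw_fun_sec. Qed.

Definition pfw_comp (g : pfwMap Y Z) (f : pfwMap X Y) : pfwMap X Z :=
  PfwMap (pfw_comp_sec g f).

Lemma pfw_triv_cts : continuous (fun x : X => pfw_sec Y (fw_proj x)).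
Proof.
by move=> x; apply: continuous_comp; [exact: fw_proj_cts|exact: pfw_sec_cts].
Qed.

Lemma pfw_triv_proj (x : X) : fw_proj (pfw_sec Y (fw_proj x)) = fw_proj x.
Proof. exact: pfw_secK. Qed.

Lemma pfw_triv_sec b : FwMap pfw_triv_cts pfw_triv_proj (pfw_sec X b) = pfw_sec Y b.
Proof. by rewrite /= pfw_secK. Qed.

Definition pfw_triv : pfwMap X Y := PfwMap pfw_triv_sec.

End PointedMaps.

Section Product.
Variables X Y : pfwSpace B.

Definition fwprod_set : set (X * Y) :=
  [set xy | fw_proj xy.1 = fw_proj xy.2].

Lemma fwprod_fst_cts :
  continuous (fun z : set_type fwprod_set => (set_val z).1).
Proof.
move=> z; apply: (@continuous_comp _ _ _ (set_val : fwprod_set -> _) fst).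
  exact: initial_continuous.
exact: cvg_fst.
Qed.

Lemma fwprod_snd_cts :
  continuous (fun z : set_type fwprod_set => (set_val z).2).
Proof.
move=> z; apply: (@continuous_comp _ _ _ (set_val : fwprod_set -> _) snd).
  exact: initial_continuous.
exact: cvg_snd.
Qed.

Lemma fwprod_proj_cts :
  continuous (fun z : set_type fwprod_set => fw_proj (set_val z).1).
Proof.
move=> z; apply: (@continuous_comp _ _ _
  (fun z : fwprod_set => (set_val z).1) (@fw_proj B X)).
  exact: fwprod_fst_cts.
exact: fw_proj_cts.
Qed.

Definition fwprod_fw : fwSpace B := FwSpace fwprod_proj_cts.

Lemma fwprod_sec_mem b : (pfw_sec X b, pfw_sec Y b) \in fwprod_set.
Proof. by rewrite inE /fwprod_set /= !pfw_secK. Qed.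

Definition fwprod_sec b : fwprod_fw :=
  exist (fun z => z \in fwprod_set) _ (fwprod_sec_mem b).

Lemma fwprod_sec_cts : continuous fwprod_sec.
Proof.
apply: continuous_comp_initial => b.
by apply: cvg_pair; exact: pfw_sec_cts.
Qed.

Lemma fwprod_secK b : fw_proj (fwprod_sec b) = b.
Proof. exact: pfw_secK. Qed.

Definition fwprod : pfwSpace B := PfwSpace fwprod_sec_cts fwprod_secK.

Lemma pr2_proj (z : fwprod) : fw_proj (set_val z).2 = fw_proj z.
Proof. by apply/esym; exact: (set_mem (valP z)). Qed.

Definition pr1 : pfwMap fwprod X :=
  @PfwMap B fwprod X (@FwMap B fwprod X _ fwprod_fst_cts (fun=> erefl)) (fun=> erefl).

Definition pr2 : pfwMap fwprod Y :=
  @PfwMap B fwprod Y (@FwMap B fwprod Y _ fwprod_snd_cts pr2_proj) (fun=> erefl).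

Section Pairing.
Variables (Z : pfwSpace B) (f : pfwMap Z X) (g : pfwMap Z Y).

Lemma pfw_pair_mem z : (f z, g z) \in fwprod_set.
Proof. by rewrite inE /fwprod_set /= !fw_fun_proj. Qed.

Definition pfw_pair_fun z : fwprod :=
  exist (fun z => z \in fwprod_set) _ (pfw_pair_mem z).

Lemma pfw_pair_cts : continuous pfw_pair_fun.
Proof.
apply: continuous_comp_initial => z.
by apply: cvg_pair; exact: fw_fun_cts.
Qed.

Lemma pfw_pair_proj z : fw_proj (pfw_pair_fun z) = fw_proj z.
Proof. exact: fw_fun_proj. Qed.

Lemma pfw_pair_sec b :
  FwMap pfw_pair_cts pfw_pair_proj (pfw_sec Z b) = pfw_sec fwprod b.
Proof. by apply: val_inj; rewrite /= !pfw_fun_sec. Qed.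

Definition pfw_pair : pfwMap Z fwprod := PfwMap pfw_pair_sec.

End Pairing.
End Product.
End Constructions.

Section Homotopy.
Variables (R : realType) (B : topologicalType).

Definition fw_homotopic (X Y : fwSpace B) (f g : fwMap X Y) : Prop :=
  exists H : fwMap (fw_cyl R X) Y,
    (forall x, H (x, zero) = f x) /\ (forall x, H (x, one) = g x).

Definition pfw_homotopic (X Y : pfwSpace B) (f g : pfwMap X Y) : Prop :=
  exists H : fwMap (fw_cyl R X) Y,
    [/\ forall x, H (x, zero) = f x,
        forall x, H (x, one) = g x &
        forall b t, H (pfw_sec X b, t) = pfw_sec Y b].

Definition fw_homotopy_equiv (X Y : fwSpace B) (f : fwMap X Y) : Prop :=
  exists g : fwMap Y X,
    fw_homotopic (fw_comp g f) (fw_id X) /\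
    fw_homotopic (fw_comp f g) (fw_id Y).

Definition pfw_homotopy_equiv (X Y : pfwSpace B) (f : pfwMap X Y) : Prop :=
  exists g : pfwMap Y X,
    pfw_homotopic (pfw_comp g f) (pfw_id X) /\
    pfw_homotopic (pfw_comp f g) (pfw_id Y).

Definition fw_cofibration (A X : fwSpace B) (u : fwMap A X) : Prop :=
  forall (Y : fwSpace B) (f : fwMap X Y) (H : fwMap (fw_cyl R A) Y),
    (forall a, H (a, zero) = f (u a)) ->
    exists K : fwMap (fw_cyl R X) Y,
      (forall x, K (x, zero) = f x) /\ (forall a t, K (u a, t) = H (a, t)).

Definition fw_well_pointed (X : pfwSpace B) : Prop :=
  fw_cofibration (fw_sec X) /\ closed (range (fw_sec X)).

Definition hurewicz_fibration (E : fwSpace B) : Prop :=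
  forall (Z : topologicalType) (f : Z -> E) (H : Z * unitI R -> B),
    continuous f -> continuous H ->
    (forall z, H (z, zero) = fw_proj (f z)) ->
    exists K : Z * unitI R -> E,
      [/\ continuous K,
          forall z, K (z, zero) = f z &
          forall zt, fw_proj (K zt) = H zt].

Definition weakly_fibrant (X : fwSpace B) : Prop :=
  exists2 E : fwSpace B, hurewicz_fibration E &
    exists f : fwMap X E, fw_homotopy_equiv f.

Section HSpace.
Variables (X : pfwSpace B) (mu : pfwMap (fwprod X X) X).

Definition fw_Hspace : Prop :=
  pfw_homotopic
    (pfw_comp mu (pfw_pair (pfw_id X) (pfw_triv X X))) (pfw_id X) /\
  pfw_homotopic
    (pfw_comp mu (pfw_pair (pfw_triv X X) (pfw_id X))) (pfw_id X).

Definition fw_shearing : pfwMap (fwprod X X) (fwprod X X) :=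
  pfw_pair (pr1 X X) mu.

Definition fw_division (delta : pfwMap (fwprod X X) X) : Prop :=
  pfw_homotopic (pfw_comp mu (pfw_pair (pr1 X X) delta)) (pr2 X X).

End HSpace.
End Homotopy.

Section Base.
Variables (R : realType) (B : topologicalType).

Definition path_connected : Prop :=
  forall x y : B, inhabited {path unitI R from x to y}.

Definition nullhomotopic (A : topologicalType) (f : A -> B) : Prop :=
  exists (c : B) (H : A * unitI R -> B),
    [/\ continuous H,
        forall a, H (a, zero) = f a &
        forall a, H (a, one) = c].

(* The finitely supported sum is the pointwise sum: by local finiteness only
   finitely many terms are nonzero at each point. *)
Definition partition_of_unity (J : choiceType) (lam : J -> B -> R) : Prop :=
  [/\ forall j, continuous (lam j),
      forall j b, 0 <= lam j b,
      forall b : B, exists2 U : set B, nbhs b U &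
        finite_set [set j | exists2 x, U x & lam j x != 0] &
      forall b, \sum_(j \in [set: J]) lam j b = 1].

Definition numerable_cover (J : choiceType) (V : J -> set B) : Prop :=
  \bigcup_j V j = [set: B] /\
  exists2 lam : J -> B -> R, partition_of_unity lam &
    forall j, closure [set b | lam j b != 0] `<=` V j.

Definition numerably_categorical : Prop :=
  exists (J : choiceType) (V : J -> set B), numerable_cover V /\
    forall j, nullhomotopic (set_val : set_type (V j) -> B).

End Base.

Definition cdisk (R : realType) n : set 'rV[R]_n := [set x | \sum_i x 0 i ^+ 2 <= 1].
Definition odisk (R : realType) n : set 'rV[R]_n := [set x | \sum_i x 0 i ^+ 2 < 1].
Definition bsphere (R : realType) n : set 'rV[R]_n := [set x | \sum_i x 0 i ^+ 2 = 1].

Arguments cdisk : clear implicits.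
Arguments odisk : clear implicits.
Arguments bsphere : clear implicits.

(* [Phi j] is the characteristic map of the [j]-th cell; only its values on the
   closed disk matter. [cw_inj] and [cw_homeo] together say that it restricts to
   a homeomorphism of the open disk onto its image, the open cell. *)
Record CW_structure (R : realType) (T : topologicalType) (J : Type) (dim : J -> nat)
    (Phi : forall j, 'rV[R]_(dim j) -> T) : Prop := {
  cw_hausdorff : hausdorff_space T;
  cw_cts : forall j, {within cdisk R (dim j), continuous (Phi j)};
  cw_inj : forall j, set_inj (odisk R (dim j)) (Phi j);
  cw_homeo : forall j (U : set 'rV[R]_(dim j)), open U ->
    exists2 V : set T, open V &
      Phi j @` (odisk R (dim j) `&` U) = Phi j @` odisk R (dim j) `&` V;
  cw_disjoint : trivIset [set: J] (fun j => Phi j @` odisk R (dim j));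
  cw_cover : \bigcup_j (Phi j @` odisk R (dim j)) = [set: T];
  cw_closure_finite : forall j, exists F : set J,
    [/\ finite_set F,
        forall k, F k -> (dim k < dim j)%N &
        Phi j @` bsphere R (dim j) `<=` \bigcup_(k in F) (Phi k @` odisk R (dim k))];
  cw_weak : forall A : set T,
    (forall j, closed (A `&` closure (Phi j @` odisk R (dim j)))) -> closed A }.

Definition CW_complex (R : realType) (T : topologicalType) : Prop :=
  exists (J : Type) (dim : J -> nat) (Phi : forall j, 'rV[R]_(dim j) -> T),
    CW_structure Phi.

(* Main.v *)
Require Import Defs.
From mathcomp Require Import all_boot all_order all_algebra.
From mathcomp Require Import all_classical all_reals all_analysis.
From mathcomp Require Import finmap lra wochoice homotopy.

(** The proof rests on a theorem of Dold ([dold_local]): a fibrewise map that is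
    a fibrewise homotopy equivalence over each set of a numerable cover is one
    globally.  It is used over [B] and over a fibre of [X].

    For maps of Hurewicz fibrations, being an equivalence can be transported
    along homotopies of the base ([pb_fhe_homotopy]).  Hence over a connected
    and numerably categorical base, a map of weak fibrations is an equivalence
    as soon as it is one on a single fibre ([dold_categorical]).  The product
    of [X] with itself is weakly fibrant over [B], so it is enough to see that
    shearing is a homotopy equivalence on the fibre [T] over [b].

    There, shearing maps [T * T] to itself and commutes with the projection to
    the first factor, so it is a map of trivial fibrations over [T].  Over the
    base point it is multiplication by the unit, which is homotopic to the
    identity.  Now [T] is a connected CW complex, and Dold's theorem applies
    once more with [T] as the base ([cw_fhe]): by induction over skeleta, where
    the next skeleton is the union of a neighbourhood that deforms into the
    last one and of the open cells, which contract; and then by neighbourhoods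
    that deform into the skeleta for the whole complex.

    To prove Dold's theorem, factor [f] through its fibrewise mapping path
    space.  The end point map [q] of this space is a fibration over the target,
    and its sections are the right inverses of [f] with their homotopies.  Where
    [f] is an equivalence, [q] is shrinkable ([shrinkable]), and local sections
    of shrinkable maps can be deformed into one another and glued
    ([glue_section]).

    The equivalence obtained so far is free.  Since [X] is well-pointed, so is
    the product ([well_pointed_fwprod]), and between well-pointed spaces a
    pointed map that is a free equivalence is a pointed one ([pointed_fhe]).
    The second component of an inverse of the shearing map is a division.

    Lifts and extensions of homotopies are compared by one device: when a
    homotopy runs forth and back along itself after projection to the base, or
    after restriction to the section, this path has a standard contraction
    ([retrace]).  Lifting or extending the contraction to a square and following
    the three other sides of the square gives a homotopy with the same ends
    that is vertical, or pointed ([palindrome_vertical], [palindrome_pointed]).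

    In names, [fwh] stands for fibrewise homotopy, [fhe] for fibrewise homotopy
    equivalence, [pfwh] for pointed fibrewise homotopy, [pb] for pullback, [mp]
    for the mapping path space and [cts] for continuity. *)

Set Implicit Arguments.
Unset Strict Implicit.
Unset Printing Implicit Defensive.
Import Order.TTheory GRing.Theory Num.Theory.
Import numFieldNormedType.Exports.
Local Open Scope classical_set_scope.
Local Open Scope ring_scope.

(** * Continuity and concatenation of homotopies *)

Section Continuity.
Variables X Y Z : topologicalType.

Lemma cts_comp (g : Y -> Z) (f : X -> Y) :
  continuous g -> continuous f -> continuous (fun x => g (f x)).
Proof. by move=> cg cf x; apply: continuous_comp; [exact: cf|exact: cg]. Qed.

Lemma cts_pair (f : X -> Y) (g : X -> Z) :
  continuous f -> continuous g -> continuous (fun x => (f x, g x)).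
Proof. by move=> cf cg x; apply: cvg_pair; [exact: cf|exact: cg]. Qed.

Lemma cts_fst (f : X -> Y * Z) : continuous f -> continuous (fun x => (f x).1).
Proof.
move=> cf x; apply: (@continuous_comp _ _ _ f fst); first exact: cf.
exact: cvg_fst.
Qed.

Lemma cts_snd (f : X -> Y * Z) : continuous f -> continuous (fun x => (f x).2).
Proof.
move=> cf x; apply: (@continuous_comp _ _ _ f snd); first exact: cf.
exact: cvg_snd.
Qed.

Lemma cts_id : continuous (fun x : X => x).
Proof. by move=> x; exact: cvg_id. Qed.

Lemma cts_cst (y : Y) : continuous (fun _ : X => y).
Proof. by move=> x; exact: cvg_cst. Qed.

Lemma cts_val (A : set Y) (f : X -> set_type A) :
  continuous f -> continuous (fun x => set_val (f x)).
Proof.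
move=> cf x; apply: (@continuous_comp _ _ _ f set_val); first exact: cf.
exact: initial_continuous.
Qed.

Lemma cts_sub (A : set Y) (f : X -> set_type A) :
  continuous (fun x => set_val (f x)) -> continuous f.
Proof. exact: continuous_comp_initial. Qed.

Lemma eq_cts (f g : X -> Y) : f =1 g -> continuous f -> continuous g.
Proof. by move=> /funext ->. Qed.

(** Each of the two restrictions is given by a function that is continuous
    everywhere: the homotopies below are pasted from formulas that make sense
    on the whole space. *)
Lemma cts_paste (C D : set X) (f g h : X -> Y) :
  closed C -> closed D -> (forall x, C x \/ D x) ->
  continuous f -> continuous g ->
  (forall x, C x -> h x = f x) -> (forall x, D x -> h x = g x) ->
  continuous h.
Proof.
move=> clC clD CD cf cg hf hg x A.
have near_in E k : closed E -> continuous k -> (forall x, E x -> h x = k x) ->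
    nbhs (h x) A -> \forall y \near x, E y -> A (h y).
  move=> clE ck hk nA; have [Ex|nEx] := pselect (E x).
    have kA : nbhs x (k @^-1` A) by apply: ck; rewrite -hk.
    by apply: filterS kA => y Ay Ey; rewrite hk.
  have oE : open (~` E) by exact: closed_openC.
  have nE : nbhs x (~` E) by apply: open_nbhs_nbhs; split.
  by apply: filterS nE => y.
move=> nA; have H1 := near_in C f clC cf hf nA.
have H2 := near_in D g clD cg hg nA.
suff : nbhs x (h @^-1` A) by [].
apply: filterS2 H1 H2 => y CA DA.
by case: (CD y) => [/CA|/DA].
Qed.

End Continuity.

Section RealContinuity.
Variables (R : realType) (X : topologicalType).
Implicit Types f g : X -> R.

Lemma cts_add f g : continuous f -> continuous g -> continuous (fun x => f x + g x).
Proof. by move=> cf cg x; apply: cvgD; [exact: cf|exact: cg]. Qed.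

Lemma cts_opp f : continuous f -> continuous (fun x => - f x).
Proof. by move=> cf x; apply: cvgN; exact: cf. Qed.

Lemma cts_mul f g : continuous f -> continuous g -> continuous (fun x => f x * g x).
Proof. by move=> cf cg x; apply: cvgM; [exact: cf|exact: cg]. Qed.

Lemma cts_max f g : continuous f -> continuous g ->
  continuous (fun x => Num.max (f x) (g x)).
Proof. by move=> cf cg x; apply: continuous_max; [exact: cf|exact: cg]. Qed.

Lemma cts_min f g : continuous f -> continuous g ->
  continuous (fun x => Num.min (f x) (g x)).
Proof. by move=> cf cg x; apply: continuous_min; [exact: cf|exact: cg]. Qed.

Lemma closed_le0 f : continuous f -> closed [set x | f x <= 0].
Proof.
move=> cf; apply: (@closed_comp _ _ f [set y | y <= 0]); last exact: closed_le.
by move=> x _; exact: cf.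
Qed.

Lemma open_gt0 f : continuous f -> open [set x | 0 < f x].
Proof.
move=> cf; apply: (@open_comp _ _ f [set y | 0 < y]); last exact: open_gt.
by move=> x _; exact: cf.
Qed.

Lemma cts_if (Y : topologicalType) f (g h : X -> Y) :
  continuous f -> continuous g -> continuous h ->
  (forall x, f x = 0 -> g x = h x) ->
  continuous (fun x => if f x <= 0 then g x else h x).
Proof.
move=> cf cg ch gh.
apply: (@cts_paste _ _ [set x | f x <= 0] [set x | - f x <= 0] g h) => //.
- exact: closed_le0.
- by apply: closed_le0; exact: cts_opp.
- by move=> x /=; rewrite oppr_le0; case: (leP (f x) 0) => [|/ltW]; [left|right].
- by move=> x /= ->.
- move=> x /=; rewrite oppr_le0 => f0; case: ifPn => // f0'.
  by apply: gh; apply/eqP; rewrite eq_le f0 f0'.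
Qed.

End RealContinuity.

Section Clamp.
Variable R : realType.

Lemma clamp_mem (x : R) :
  Num.max 0 (Num.min 1 x) \in (`[0%R, 1%R]%classic : set R).
Proof. by rewrite mem_setE in_itv /= le_max lexx /= ge_max ler01 ge_min lexx. Qed.

(** The retraction of the line onto the unit interval.  It lets formulas on
    the interval be written and proved continuous as formulas on the line. *)
Definition clamp (x : R) : unitI R :=
  exist (fun y => y \in (`[0%R, 1%R]%classic : set R)) _ (clamp_mem x).

Definition uval (t : unitI R) : R := set_val t.

Lemma clampE x : uval (clamp x) = Num.max 0 (Num.min 1 x).
Proof. by []. Qed.

Lemma unitI_ge0 (t : unitI R) : 0 <= uval t.
Proof. by have := set_valP t; rewrite /uval /= in_itv /= => /andP[]. Qed.

Lemma unitI_le1 (t : unitI R) : uval t <= 1.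
Proof. by have := set_valP t; rewrite /uval /= in_itv /= => /andP[]. Qed.

Lemma clampK (t : unitI R) : clamp (uval t) = t.
Proof.
by apply: val_inj => /=; rewrite (min_idPr (unitI_le1 t)) (max_idPr (unitI_ge0 t)).
Qed.

Lemma clamp_id x : 0 <= x -> x <= 1 -> uval (clamp x) = x.
Proof. by move=> x0 x1; rewrite clampE (min_idPr x1) (max_idPr x0). Qed.

Lemma val_zero : uval (zero : unitI R) = 0.
Proof. by []. Qed.

Lemma val_one : uval (one : unitI R) = 1.
Proof. by []. Qed.

Lemma clamp0 x : x <= 0 -> clamp x = zero.
Proof.
move=> x0; apply: val_inj; rewrite /= (min_idPr _) ?(max_idPl _) //.
exact: (le_trans x0 ler01).
Qed.

Lemma clamp1 x : 1 <= x -> clamp x = one.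
Proof.
by move=> x1; apply: val_inj; rewrite /= (min_idPl x1) (max_idPr ler01).
Qed.

Lemma cts_uval (X : topologicalType) (f : X -> unitI R) :
  continuous f -> continuous (fun x => uval (f x)).
Proof. exact: cts_val. Qed.

Lemma cts_clamp (X : topologicalType) (f : X -> R) :
  continuous f -> continuous (fun x => clamp (f x)).
Proof.
move=> cf; apply: cts_sub; under eq_fun do rewrite -/(uval _) clampE.
by apply: cts_max; [exact: cts_cst|apply: cts_min => //; exact: cts_cst].
Qed.

End Clamp.

(** Directed by the syntax of the goal, so that no decomposition of a function
    into composites has to be found by unification. *)
Ltac cts1 := cbv beta; match goal with
  | H : continuous ?f |- continuous ?f => refine H
  | |- continuous (fun x => x) => refine (@cts_id _)
  | |- continuous (fun x => ?c) => refine (@cts_cst _ _ c)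
  | |- continuous (fun x => (@?f x, @?g x)) => refine (@cts_pair _ _ _ f g _ _)
  | |- continuous (fun x => (@?f x).1) => refine (@cts_fst _ _ _ f _)
  | |- continuous (fun x => (@?f x).2) => refine (@cts_snd _ _ _ f _)
  | |- continuous (fun x => clamp (@?f x)) => refine (@cts_clamp _ _ f _)
  | |- continuous (fun x => uval (@?f x)) => refine (@cts_uval _ _ f _)
  | |- continuous (fun x => set_val (@?f x)) => refine (@cts_val _ _ _ f _)
  | |- continuous (fun x => (@?f x + @?g x)%R) => refine (@cts_add _ _ f g _ _)
  | |- continuous (fun x => (- @?f x)%R) => refine (@cts_opp _ _ f _)
  | |- continuous (fun x => (@?f x * @?g x)%R) => refine (@cts_mul _ _ f g _ _)
  | |- continuous (fun x => Order.max (@?f x) (@?g x)) =>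
      refine (@cts_max _ _ f g _ _)
  | |- continuous (fun x => Order.min (@?f x) (@?g x)) =>
      refine (@cts_min _ _ f g _ _)
  | H : continuous ?h |- continuous (fun x => ?h (@?f x)) =>
      refine (@cts_comp _ _ _ h f H _)
  | |- continuous (fun x => @fw_proj ?B ?X (@?f x)) =>
      refine (@cts_comp _ _ _ (@fw_proj B X) f (@fw_proj_cts B X) _)
  | |- continuous (fun x => @pfw_sec ?B ?X (@?f x)) =>
      refine (@cts_comp _ _ _ (@pfw_sec B X) f (@pfw_sec_cts B X) _)
  | |- continuous (fun x => @fw_fun ?B ?X ?Y ?h (@?f x)) =>
      refine (@cts_comp _ _ _ (@fw_fun B X Y h) f (@fw_fun_cts B X Y h) _)
  | |- continuous (@fw_fun _ _ _ _) => refine (fw_fun_cts _)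
  | |- continuous (@fw_proj _ _) => refine (fw_proj_cts _)
  | |- continuous (@pfw_sec _ _) => refine (pfw_sec_cts _)
  end.
Ltac cts := repeat cts1.

Section HomotopyOperations.
Variables (R : realType) (X Y : topologicalType).
Implicit Types h k : X * unitI R -> Y.

Definition hrev h : X * unitI R -> Y := fun z => h (z.1, clamp (1 - uval z.2)).

Definition hcat h k : X * unitI R -> Y := fun z =>
  if 2 * uval z.2 - 1 <= 0 then h (z.1, clamp (2 * uval z.2))
  else k (z.1, clamp (2 * uval z.2 - 1)).

Lemma cts_hrev h : continuous h -> continuous (hrev h).
Proof. by move=> ch; rewrite /hrev; cts. Qed.

Lemma hrev0 h x : hrev h (x, zero) = h (x, one).
Proof. by rewrite /hrev /= val_zero subr0 clamp1. Qed.

Lemma hrev1 h x : hrev h (x, one) = h (x, zero).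
Proof. by rewrite /hrev /= val_one subrr clamp0. Qed.

Lemma cts_hcat h k : continuous h -> continuous k ->
  (forall x, h (x, one) = k (x, zero)) -> continuous (hcat h k).
Proof.
move=> ch ck hk; apply: cts_if; [by cts..|] => -[x t] /= t0.
by rewrite t0 (_ : 2 * _ = 1) ?(clamp1 (lexx 1)) ?(clamp0 (lexx 0)) //; lra.
Qed.

Lemma hcat0 h k x : hcat h k (x, zero) = h (x, zero).
Proof. by rewrite /hcat /= val_zero mulr0 ifT ?clamp0 //; lra. Qed.

Lemma hcat1 h k x : hcat h k (x, one) = k (x, one).
Proof.
rewrite /hcat /= val_one ifF ?clamp1 //; first by lra.
by apply/negbTE; rewrite -ltNge; lra.
Qed.

Lemma hcatP (P : Y -> Prop) h k x :
  (forall t, P (h (x, t))) -> (forall t, P (k (x, t))) ->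
  forall t, P (hcat h k (x, t)).
Proof. by move=> hP kP t; rewrite /hcat; case: ifP => _; [exact: hP|exact: kP]. Qed.

End HomotopyOperations.


(** * Fibrewise homotopy and pullbacks *)

Section FibrewiseHomotopy.
Variables (R : realType) (B : topologicalType).
Implicit Types X Y Z : fwSpace B.
Notation "f ~~ g" := (@fw_homotopic R B _ _ f g) (at level 70).
Notation fhe := (@fw_homotopy_equiv R B _ _).

Lemma fwhI X Y (f g : fwMap X Y) (h : X * unitI R -> Y) : continuous h ->
  (forall x t, fw_proj (h (x, t)) = fw_proj x) ->
  (forall x, h (x, zero) = f x) -> (forall x, h (x, one) = g x) -> f ~~ g.
Proof.
move=> ch hp h0 h1.
by exists (@FwMap B (fw_cyl R X) Y h ch (fun xt => let: (x, t) := xt in hp x t)).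
Qed.

Lemma fwhE X Y (f g : fwMap X Y) : f ~~ g -> exists h : X * unitI R -> Y,
  [/\ continuous h, forall x t, fw_proj (h (x, t)) = fw_proj x,
      forall x, h (x, zero) = f x & forall x, h (x, one) = g x].
Proof.
case=> H [H0 H1]; exists H; split => //; first exact: (fw_fun_cts H).
by move=> x t; exact: (fw_fun_proj H (x, t)).
Qed.

Lemma fwh_refl X Y (f g : fwMap X Y) : f =1 g -> f ~~ g.
Proof.
move=> fg; apply: (@fwhI X Y f g (fun z => f z.1)) => // [|x t].
  by cts.
by rewrite fw_fun_proj.
Qed.

Lemma fwh_sym X Y (f g : fwMap X Y) : f ~~ g -> g ~~ f.
Proof.
case/fwhE => h [ch hp h0 h1]; apply: (@fwhI X Y g f (hrev h)).
- exact: cts_hrev.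
- by move=> x t; rewrite hp.
- by move=> x; rewrite hrev0.
- by move=> x; rewrite hrev1.
Qed.

Lemma fwh_trans X Y (g f k : fwMap X Y) : f ~~ g -> g ~~ k -> f ~~ k.
Proof.
case/fwhE => h [ch hp h0 h1] /fwhE[l [cl lp l0 l1]].
apply: (@fwhI X Y f k (hcat h l)).
- by apply: cts_hcat => // x; rewrite h1 l0.
- by move=> x; apply: (hcatP (P := fun y => fw_proj y = fw_proj x)).
- by move=> x; rewrite hcat0.
- by move=> x; rewrite hcat1.
Qed.

Lemma fwh_compl X Y Z (g : fwMap Y Z) (f f' : fwMap X Y) :
  f ~~ f' -> fw_comp g f ~~ fw_comp g f'.
Proof.
case/fwhE => h [ch hp h0 h1].
apply: (@fwhI X Z _ _ (fun z => g (h z))) => [|x t|x|x].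
- by cts.
- by rewrite fw_fun_proj hp.
- by rewrite h0.
- by rewrite h1.
Qed.

Lemma fwh_compr X Y Z (g g' : fwMap Y Z) (f : fwMap X Y) :
  g ~~ g' -> fw_comp g f ~~ fw_comp g' f.
Proof.
case/fwhE => h [ch hp h0 h1].
apply: (@fwhI X Z _ _ (fun z => h (f z.1, z.2))) => [|x t|x|x].
- by cts.
- by rewrite hp fw_fun_proj.
- by rewrite h0.
- by rewrite h1.
Qed.

(** Both one-sided inverses agree: [l] is homotopic to [l f r], hence to [r]. *)
Lemma fhe_lr X Y (f : fwMap X Y) (l r : fwMap Y X) :
  fw_comp l f ~~ fw_id X -> fw_comp f r ~~ fw_id Y -> fhe f.
Proof.
move=> lf fr; exists r; split => //.
apply: (fwh_trans _ lf); apply: fwh_compr; apply: fwh_sym.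
apply: (@fwh_trans _ _ (fw_comp l (fw_comp f r))).
  apply: fwh_trans (fwh_compl l (fwh_sym fr)); exact: fwh_refl.
apply: (@fwh_trans _ _ (fw_comp (fw_comp l f) r)); first exact: fwh_refl.
apply: fwh_trans (fwh_compr r lf) _; exact: fwh_refl.
Qed.

Lemma fhe_homotopic X Y (f g : fwMap X Y) : f ~~ g -> fhe f -> fhe g.
Proof.
move=> fg [h [hf fh]]; exists h; split.
  by apply: fwh_trans hf; apply: fwh_compl; exact: fwh_sym.
by apply: fwh_trans fh; apply: fwh_compr; exact: fwh_sym.
Qed.

Lemma fhe_comp X Y Z (g : fwMap Y Z) (f : fwMap X Y) :
  fhe g -> fhe f -> fhe (fw_comp g f).
Proof.
move=> [g' [g'g gg']] [f' [f'f ff']]; exists (fw_comp f' g'); split.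
  apply: fwh_trans f'f; apply: (@fwh_trans _ _ (fw_comp f' (fw_comp (fw_comp g' g) f))).
    exact: fwh_refl.
  by apply: fwh_compl; apply: fwh_trans (fwh_compr f g'g) _; exact: fwh_refl.
apply: fwh_trans gg'; apply: (@fwh_trans _ _ (fw_comp g (fw_comp (fw_comp f f') g'))).
  exact: fwh_refl.
by apply: fwh_compl; apply: fwh_trans (fwh_compr g' ff') _; exact: fwh_refl.
Qed.

Lemma fhe_inv X Y (f : fwMap X Y) (g : fwMap Y X) :
  fhe f -> fw_comp f g ~~ fw_id Y -> fhe g.
Proof.
move=> [h [hf fh]] fg; exists f; split => //.
apply: (fwh_trans _ hf); apply: fwh_compr.
apply: (@fwh_trans _ _ (fw_comp h (fw_comp f g))).
  apply: (@fwh_trans _ _ (fw_comp (fw_comp h f) g)); last exact: fwh_refl.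
  apply: fwh_sym; apply: fwh_trans (fwh_compr g hf) _; exact: fwh_refl.
by apply: fwh_trans (fwh_compl h fg) _; exact: fwh_refl.
Qed.

Lemma fhe_cancel_l X Y Z (g : fwMap Y Z) (f : fwMap X Y) :
  fhe g -> fhe (fw_comp g f) -> fhe f.
Proof.
move=> [g' [g'g gg']] gf.
have g'E : fhe g' by exists g.
apply: fhe_homotopic (fhe_comp g'E gf).
apply: (@fwh_trans _ _ (fw_comp (fw_comp g' g) f)); first exact: fwh_refl.
by apply: fwh_trans (fwh_compr f g'g) _; exact: fwh_refl.
Qed.

Lemma fhe_cancel_r X Y Z (g : fwMap Y Z) (f : fwMap X Y) :
  fhe f -> fhe (fw_comp g f) -> fhe g.
Proof.
move=> [f' [f'f ff']] gf.
have f'E : fhe f' by exists f.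
apply: fhe_homotopic (fhe_comp gf f'E).
apply: (@fwh_trans _ _ (fw_comp g (fw_comp f f'))); first exact: fwh_refl.
by apply: fwh_trans (fwh_compl g ff') _; exact: fwh_refl.
Qed.

Lemma fhe_iso X Y (f : fwMap X Y) (g : fwMap Y X) :
  cancel f g -> cancel g f -> fhe f.
Proof. by move=> fK gK; exists g; split; apply: fwh_refl. Qed.

Lemma fhe_conj X Y X' Y' (u : fwMap X X') (v : fwMap Y Y')
    (f : fwMap X Y) (f' : fwMap X' Y') :
  fhe u -> fhe v -> fw_comp v f ~~ fw_comp f' u -> fhe f <-> fhe f'.
Proof.
move=> fu fv vf; split => [ff|ff'].
  exact/(fhe_cancel_r fu)/(fhe_homotopic vf)/fhe_comp.
apply: (fhe_cancel_l fv); apply: (fhe_homotopic (fwh_sym vf)).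
exact: fhe_comp.
Qed.

End FibrewiseHomotopy.

Section Pullback.
Variables (R : realType) (B : topologicalType).

Section Space.
Variables (A : topologicalType) (a : A -> B).
Implicit Types X Y : fwSpace B.

Definition pb_set X : set (A * X) := [set z | fw_proj z.2 = a z.1].
Arguments pb_set : clear implicits.

Lemma pb_proj_cts X : continuous (fun z : set_type (pb_set X) => (set_val z).1).
Proof. by cts. Qed.

Definition pb X : fwSpace A := FwSpace (@pb_proj_cts X).

Definition pb_mk X (c : A) (x : X) (H : fw_proj x = a c) : pb X :=
  exist (fun z => z \in pb_set X) (c, x) (mem_set (H : pb_set X (c, x))).

Lemma pb_cts X (Z : topologicalType) (c : Z -> A) (x : Z -> X)
    (H : forall z, fw_proj (x z) = a (c z)) :
  continuous c -> continuous x -> continuous (fun z => pb_mk (H z)).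
Proof. by move=> cc cx; apply: cts_sub; exact: cts_pair. Qed.

Lemma pb_eq X (z : pb X) : fw_proj (set_val z).2 = a (fw_proj z).
Proof. exact: (set_valP z). Qed.

Lemma pb_inj X (z z' : pb X) :
  fw_proj z = fw_proj z' -> (set_val z).2 = (set_val z').2 -> z = z'.
Proof.
case: z z' => [[c x] H] [[c' x'] H'] /= e e'; apply: val_inj => /=.
by move: e e' => /= -> ->.
Qed.

Definition pb_map_mem X Y (f : fwMap X Y) (z : pb X) :
  fw_proj (f (set_val z).2) = a (fw_proj z).
Proof. by rewrite fw_fun_proj pb_eq. Qed.

Definition pb_fun X Y (f : fwMap X Y) (z : pb X) : pb Y :=
  pb_mk (pb_map_mem f z).

Lemma pb_fun_cts X Y (f : fwMap X Y) : continuous (pb_fun f).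
Proof. by apply: pb_cts; cts. Qed.

Definition pb_map X Y (f : fwMap X Y) : fwMap (pb X) (pb Y) :=
  @FwMap A (pb X) (pb Y) (pb_fun f) (@pb_fun_cts _ _ f) (fun=> erefl).

Lemma pb_homotopic X Y (f g : fwMap X Y) :
  fw_homotopic R f g -> fw_homotopic R (pb_map f) (pb_map g).
Proof.
case/fwhE => h [ch hp h0 h1].
have mem (z : pb X * unitI R) : fw_proj (h ((set_val z.1).2, z.2)) = a (fw_proj z.1).
  by rewrite hp pb_eq.
apply: (@fwhI R A (pb X) (pb Y) _ _ (fun z => pb_mk (mem z))) => //.
- by apply: pb_cts; cts.
- by move=> x; apply: pb_inj => //=; rewrite h0.
- by move=> x; apply: pb_inj => //=; rewrite h1.
Qed.

Lemma pb_fhe X Y (f : fwMap X Y) :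
  fw_homotopy_equiv R f -> fw_homotopy_equiv R (pb_map f).
Proof.
case=> g [/pb_homotopic gf /pb_homotopic fg]; exists (pb_map g); split.
  apply: (fwh_trans _ (fwh_trans gf _)); apply: fwh_refl => z; exact: pb_inj.
apply: (fwh_trans _ (fwh_trans fg _)); apply: fwh_refl => z; exact: pb_inj.
Qed.

End Space.
End Pullback.

Section Composite.
Variables (R : realType) (B A A' : topologicalType) (a : A -> B) (k : A' -> A).
Hypothesis k_cts : continuous k.
Implicit Types X Y : fwSpace B.

Lemma pb_split_mem1 X (z : pb (fun c => a (k c)) X) :
  fw_proj (set_val z).2 = a (k (fw_proj z)).
Proof. exact: pb_eq. Qed.

Definition pb_split_fun X (z : pb (fun c => a (k c)) X) : pb k (pb a X) :=
  @pb_mk A A' k (pb a X) (fw_proj z)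
    (@pb_mk B A a X (k (fw_proj z)) _ (pb_split_mem1 z)) erefl.

Lemma pb_split_cts X : continuous (@pb_split_fun X).
Proof.
by apply: pb_cts; [cts|apply: pb_cts; cts].
Qed.

Definition pb_split X : fwMap (pb (fun c => a (k c)) X) (pb k (pb a X)) :=
  @FwMap A' _ (pb k (pb a X)) (@pb_split_fun X) (@pb_split_cts X) (fun=> erefl).

Lemma pb_merge_mem X (z : pb k (pb a X)) :
  fw_proj (set_val (set_val z).2).2 = a (k (fw_proj z)).
Proof. by rewrite pb_eq pb_eq. Qed.

Definition pb_merge_fun X (z : pb k (pb a X)) : pb (fun c => a (k c)) X :=
  @pb_mk B A' (fun c => a (k c)) X (fw_proj z) _ (pb_merge_mem z).

Lemma pb_merge_cts X : continuous (@pb_merge_fun X).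
Proof. by apply: pb_cts; cts. Qed.

Definition pb_merge X : fwMap (pb k (pb a X)) (pb (fun c => a (k c)) X) :=
  @FwMap A' (pb k (pb a X)) _ (@pb_merge_fun X) (@pb_merge_cts X) (fun=> erefl).

Lemma pb_split_fhe X : fw_homotopy_equiv R (pb_split X).
Proof.
apply: (@fhe_iso R A' _ _ (pb_split X) (pb_merge X)) => z.
  exact: pb_inj.
by apply: pb_inj => //; apply: pb_inj => //; exact: esym (pb_eq z).
Qed.

(** In the iterated pullback the component in [A] is redundant. *)
Lemma pb_pb X Y (f : fwMap X Y) :
  fw_homotopy_equiv R (pb_map (fun c => a (k c)) f) <->
  fw_homotopy_equiv R (pb_map k (pb_map a f)).
Proof.
apply: (fhe_conj (pb_split_fhe X) (pb_split_fhe Y)).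
by apply: fwh_refl => z; apply: pb_inj => //; apply: pb_inj.
Qed.

Lemma pb_fhe_comp X Y (f : fwMap X Y) :
  fw_homotopy_equiv R (pb_map a f) ->
  fw_homotopy_equiv R (pb_map (fun c => a (k c)) f).
Proof. by move=> af; apply/pb_pb/pb_fhe. Qed.

End Composite.

(** * Paths that run forth and back *)

Section UnitIntervalCompact.
Variable R : realType.

Lemma unitI_compact : compact [set: unitI R].
Proof.
have <- : @clamp R @` `[0, 1] = [set: unitI R].
  apply/seteqP; split => // t _; exists (uval t); last exact: clampK.
  by rewrite /= in_itv /= unitI_ge0 unitI_le1.
apply: continuous_compact; last exact: segment_compact.
by apply: continuous_subspaceT; exact: (cts_clamp (@cts_id R)).
Qed.

Lemma unitI_hausdorff : hausdorff_space (unitI R).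
Proof.
move=> s t st; apply: val_inj; apply: (@Rhausdorff R) => U V Us Vt.
have cu : continuous (@uval R) by apply: cts_uval; exact: cts_id.
by have [u [? ?]] := st _ _ (cu s U Us) (cu t V Vt); exists (uval u).
Qed.

Lemma unitI_locally_compact : locally_compact [set: unitI R].
Proof.
move=> t _; rewrite withinET; exists [set: unitI R]; first exact: filterT.
by split; [exact: unitI_compact|exact: closedT].
Qed.

End UnitIntervalCompact.

Section Palindrome.
Variables (R : realType) (E B : topologicalType) (p : E -> B).
Variables (Z : topologicalType) (M : Z * unitI R -> E).

(** The standard contraction of the path [p (M (z, t))], when it runs forth and
    back along itself: the second parameter cuts the path shorter and shorter. *)
Definition retrace (z : (Z * unitI R) * unitI R) : B :=
  p (M (z.1.1, clamp (Num.min (Num.min (uval z.1.2) (1 - uval z.1.2))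
                              (2^-1 * (1 - uval z.2))))).

Lemma cts_retrace : continuous p -> continuous M -> continuous retrace.
Proof. by move=> cp cM; rewrite /retrace; cts. Qed.

Hypothesis M_cts : continuous M.
Hypothesis pM_sym : forall z t, p (M (z, clamp (1 - uval t))) = p (M (z, t)).

Lemma retrace0 z : retrace (z, zero) = p (M z).
Proof.
case: z => z t; rewrite /retrace /= val_zero subr0 mulr1.
case: (leP (uval t) (1 - uval t)) => ht.
  by rewrite (min_idPl _) ?clampK //; lra.
by rewrite (min_idPl _) ?pM_sym //; lra.
Qed.

Lemma retrace1 z t : retrace (z, t, one) = p (M (z, zero)).
Proof.
rewrite /retrace /= val_one subrr mulr0 clamp0 //.
by rewrite ge_min lexx orbT.
Qed.

Lemma retrace_end z t : retrace (z, zero, t) = p (M (z, zero)) /\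
                       retrace (z, one, t) = p (M (z, zero)).
Proof.
have ? := unitI_le1 t; have ? := unitI_ge0 t.
rewrite /retrace /= val_zero val_one subr0 subrr.
by split; rewrite clamp0 // !ge_min lexx ?orbT.
Qed.

(** Follow a lift of the contraction along the three other sides of the square:
    the contraction is stationary there, so that this path is vertical. *)
Lemma palindrome_vertical :
  (exists2 K : (Z * unitI R) * unitI R -> E, continuous K &
     (forall z, K (z, zero) = M z) /\ (forall z, p (K z) = retrace z)) ->
  exists D : Z * unitI R -> E,
    [/\ continuous D, forall z, D (z, zero) = M (z, zero),
        forall z, D (z, one) = M (z, one) &
        forall z t, p (D (z, t)) = p (M (z, zero))].
Proof.
case=> K cK [K0 pK].
pose L z : E := K ((z.1, zero), z.2).
pose T z : E := K ((z.1, z.2), one).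
pose F z : E := K ((z.1, one), z.2).
have cL : continuous (L : Z * unitI R -> E) by rewrite /L; cts.
have cT : continuous (T : Z * unitI R -> E) by rewrite /T; cts.
have cF : continuous (F : Z * unitI R -> E) by rewrite /F; cts.
exists (hcat (hcat L T) (hrev F)); split.
- apply: cts_hcat; first by apply: cts_hcat.
    exact: cts_hrev.
  by move=> z; rewrite hcat1 hrev0.
- by move=> z; rewrite !hcat0 /L K0.
- by move=> z; rewrite hcat1 hrev1 /F K0.
- move=> z; apply: (hcatP (P := fun e => p e = p (M (z, zero)))).
    apply: (hcatP (P := fun e => p e = p (M (z, zero)))) => t.
      by rewrite pK; have [] := retrace_end z t.
    by rewrite pK retrace1.
  by move=> t; rewrite /hrev /F /= pK; have [] := retrace_end z (clamp (1 - uval t)).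
Qed.

End Palindrome.

(** * Shrinkable maps and the mapping path space *)

Section VerticalLifting.
Variables (R : realType) (B : topologicalType).
Implicit Types W C : fwSpace B.

(** Being a fibration in the category of spaces over [B]. *)
Definition vertical_lifting W C (q : fwMap W C) : Prop :=
  forall (Z : topologicalType) (k : Z -> W) (H : Z * unitI R -> C),
    continuous k -> continuous H ->
    (forall z, H (z, zero) = q (k z)) ->
    (forall z t, fw_proj (H (z, t)) = fw_proj (k z)) ->
    exists2 K : Z * unitI R -> W, continuous K &
      (forall z, K (z, zero) = k z) /\ (forall z, q (K z) = H z).

(** Lifting turns a homotopy inverse into a strict section [s].  The homotopy
    [L] from [s q] to the identity need not be over [C], but the reverse of
    [s q L] followed by [L] projects to a path that runs forth and back, so
    that its ends are homotopic over [C]. *)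
Lemma shrinkable W C (q : fwMap W C) :
  vertical_lifting q -> fw_homotopy_equiv R q ->
  exists (s : fwMap C W) (T : W * unitI R -> W),
    [/\ continuous T, forall c, q (s c) = c, forall w t, q (T (w, t)) = q w,
        forall w, T (w, zero) = s (q w) & forall w, T (w, one) = w].
Proof.
move=> lq [g [gq qg]].
have [h [ch hp h0 h1]] := fwhE qg.
have cg : continuous g by exact: fw_fun_cts.
have cq : continuous q by exact: fw_fun_cts.
have [|K cK [K0 qK]] := lq C g h cg ch h0; first by move=> c t; rewrite hp fw_fun_proj.
have s_cts : continuous (fun c => K (c, one)) by cts.
have s_proj c : fw_proj (K (c, one)) = fw_proj c.
  by rewrite -[LHS](fw_fun_proj q) qK h1.
pose s : fwMap C W := FwMap s_cts s_proj.
have qs c : q (s c) = c by rewrite /= qK h1.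
have [L [cL Lp L0 L1]] : exists h : W * unitI R -> W,
    [/\ continuous h, forall x t, fw_proj (h (x, t)) = fw_proj x,
        forall x, h (x, zero) = s (q x) & forall x, h (x, one) = x].
  apply: (@fwhE R B W W (fw_comp s q) (fw_id W)).
  apply: fwh_trans gq; apply: fwh_compr; apply: fwh_sym.
  apply: (@fwhI R B C W g s K) => // x t.
  by rewrite -[LHS](fw_fun_proj q) qK hp.
pose G z := s (q (L z)).
have cG : continuous G by rewrite /G; cts.
pose M := hcat (hrev G) L.
have cM : continuous M.
  apply: cts_hcat => //; first exact: cts_hrev.
  by move=> x; rewrite hrev1 /G !L0 qs.
have pM x t : fw_proj (M (x, t)) = fw_proj x.
  apply: (hcatP (P := fun y => fw_proj y = fw_proj x)) => {}t.
    by rewrite /hrev /G !fw_fun_proj Lp.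
  exact: Lp.
have qM x t : q (M (x, clamp (1 - uval t))) = q (M (x, t)).
  have ? := unitI_ge0 t; have ? := unitI_le1 t.
  rewrite /M /hcat /hrev /G /= clamp_id; [|lra..].
  case: (ltrgtP (2 * uval t - 1) 0) => ht.
  - rewrite ifF; last by apply/negbTE; rewrite -ltNge; lra.
    by rewrite qs clamp_id; [congr (q (L (_, clamp _)))|..]; lra.
  - rewrite ifT; last by lra.
    by rewrite qs clamp_id; [congr (q (L (_, clamp _)))|..]; lra.
  - rewrite ifT; last by lra.
    by congr (q (s (q (L (_, clamp (1 - uval (clamp _))))))); lra.
have [|T [cT T0 T1 qT]] := @palindrome_vertical R W C q W M.
  apply: (lq (W * unitI R)%type M) => //.
  - exact: cts_retrace.
  - by move=> z; exact: retrace0.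
  - move=> [x u] t; by rewrite /retrace fw_fun_proj !pM.
exists s, T; split => //.
- move=> w t; rewrite qT /M hcat0 hrev0 /G L1; exact: qs.
- by move=> w; rewrite T0 /M hcat0 hrev0 /G L1.
- by move=> w; rewrite T1 /M hcat1 L1.
Qed.

End VerticalLifting.

Lemma vertical_lifting_pb (R : realType) (A B : topologicalType) (a : A -> B)
    (W C : fwSpace B) (q : fwMap W C) :
  vertical_lifting R q -> vertical_lifting R (pb_map a q).
Proof.
move=> lq Z k H ck cH H0 Hp.
have [|||z t|K cK [K0 qK]] :=
  lq Z (fun z => (set_val (k z)).2) (fun z => (set_val (H z)).2).
- by cts.
- by cts.
- by move=> z; rewrite H0.
- by rewrite !pb_eq Hp.
have mem z : fw_proj (K z) = a (fw_proj (k z.1)).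
  by rewrite -(fw_fun_proj q) qK pb_eq; case: z => z t; rewrite Hp.
exists (fun z => pb_mk (mem z)); first by apply: pb_cts; cts.
split=> [z|[z t]]; first by apply: pb_inj => //=; rewrite K0.
by apply: pb_inj; [exact: esym (Hp z t)|rewrite /= qK].
Qed.

Section MappingPathSpace.
Variables (R : realType) (B : topologicalType) (E E' : fwSpace B).
Variable f : fwMap E E'.

Definition mp_set : set (E * {compact-open, unitI R -> E'}) :=
  [set z | [/\ continuous (z.2 : unitI R -> E'), z.2 zero = f z.1 &
            forall t, fw_proj (z.2 t : E') = fw_proj z.1]].

Lemma mp_proj_cts : continuous (fun z : set_type mp_set => fw_proj (set_val z).1).
Proof. by cts. Qed.

(** The fibrewise mapping path space of [f].  A section of its end point map is
    a right inverse of [f] together with the homotopy that makes it one. *)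
Definition mp : fwSpace B := FwSpace mp_proj_cts.

Definition mp_ev (z : mp * unitI R) : E' := (set_val z.1).2 z.2.

Lemma mp_ev_cts : continuous mp_ev.
Proof.
pose g (w : mp) : unitI R -> E' := (set_val w).2.
have -> : mp_ev = uncurry g by apply/funext => -[].
apply: continuous_uncurry.
- exact: unitI_locally_compact.
- exact: unitI_hausdorff.
- apply: (@cts_snd mp E {compact-open, unitI R -> E'} set_val).
  by apply: (@cts_val mp); exact: cts_id.
- by move=> w; have [] := set_valP w.
Qed.

Lemma mp_ev0 w : mp_ev (w, zero) = f (set_val w).1.
Proof. by have [] := set_valP w. Qed.

Lemma mp_ev_proj w t : fw_proj (mp_ev (w, t)) = fw_proj w.
Proof. by have [_ _] := set_valP w; apply. Qed.

Lemma mp_inj (w w' : mp) : (set_val w).1 = (set_val w').1 ->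
  (forall t, mp_ev (w, t) = mp_ev (w', t)) -> w = w'.
Proof.
rewrite /mp_ev /=; case: w w' => [[e u] H] [[e' u'] H'] /= ee' uu'.
by apply: val_inj => /=; rewrite ee'; congr pair; exact: funext.
Qed.

Section Maps.
Variables (Z : topologicalType) (e : Z -> E) (u : Z * unitI R -> E').
Hypotheses (e_cts : continuous e) (u_cts : continuous u).
Hypothesis u0 : forall z, u (z, zero) = f (e z).
Hypothesis up : forall z t, fw_proj (u (z, t)) = fw_proj (e z).

Lemma mp_mk_mem z : mp_set (e z, curry u z).
Proof.
split; [|exact: u0|by move=> t; exact: up].
by have [_] := continuous_curry u_cts; apply.
Qed.

Definition mp_mk z : mp := exist (fun z => z \in mp_set) _ (mem_set (mp_mk_mem z)).

Lemma mp_mk_cts : continuous mp_mk.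
Proof.
apply: (@cts_sub Z _ mp_set mp_mk).
apply: (@cts_pair Z E {compact-open, unitI R -> E'} e (curry u)) => //.
by have [] := continuous_curry u_cts.
Qed.

End Maps.

Lemma mp_end_cts : continuous (fun w : mp => mp_ev (w, one)).
Proof. by have ? := mp_ev_cts; cts. Qed.

Definition mp_end : fwMap mp E' :=
  @FwMap B mp E' _ mp_end_cts (fun w => mp_ev_proj w one).

Lemma mp_start_cts : continuous (fun w : mp => (set_val w).1).
Proof. by cts. Qed.

Definition mp_start : fwMap mp E := @FwMap B mp E _ mp_start_cts (fun=> erefl).

(** A path can be contracted to its starting point. *)
Lemma mp_start_fhe : fw_homotopy_equiv R mp_start.
Proof.
have cev := mp_ev_cts.
have c_cts : continuous (fun z : E * unitI R => f z.1) by cts.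
have c0 (z : E) : f z = f z by [].
have cp (z : E) (t : unitI R) : fw_proj (f z) = fw_proj z by rewrite fw_fun_proj.
pose c := @mp_mk E (fun z => z) (fun z => f z.1) c_cts c0 cp.
have c_mp_cts : continuous c by exact: (@mp_mk_cts E _ _ (@cts_id E) c_cts c0 cp).
pose C : fwMap E mp := @FwMap B E mp c c_mp_cts (fun=> erefl).
exists C; split; last exact: fwh_refl.
have e_cts : continuous (fun z : mp * unitI R => (set_val z.1).1) by cts.
pose u (z : (mp * unitI R) * unitI R) :=
  mp_ev (z.1.1, clamp (Num.min (uval z.1.2) (uval z.2))).
have u_cts : continuous u by rewrite /u; cts.
have u0 z : u (z, zero) = f (set_val z.1).1.
  rewrite /u /= val_zero clamp0 ?mp_ev0 //.
  by rewrite ge_min lexx orbT.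
have up z t : fw_proj (u (z, t)) = fw_proj (set_val z.1).1 by rewrite /u mp_ev_proj.
apply: (@fwhI R B mp mp _ _ (mp_mk u_cts u0 up)) => //.
- exact: mp_mk_cts.
- move=> w; apply: mp_inj => // t; rewrite /mp_ev /= /curry /u /= val_zero.
  by rewrite clamp0 ?mp_ev0 // ge_min lexx.
- move=> w; apply: mp_inj => // t; rewrite /mp_ev /= /curry /u /= val_one.
  by rewrite (min_idPr (unitI_le1 t)) clampK.
Qed.

(** Run backwards along the path. *)
Lemma mp_end_homotopic : fw_homotopic R mp_end (fw_comp f mp_start).
Proof.
have cev := mp_ev_cts.
apply: (@fwhI R B mp E' _ _ (fun z => mp_ev (z.1, clamp (1 - uval z.2)))) => //.
- by cts.
- by move=> w t; rewrite mp_ev_proj.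
- by move=> w; rewrite /= val_zero subr0 clamp1.
- by move=> w; rewrite /= val_one subrr clamp0 // mp_ev0.
Qed.

(** A lift is obtained by appending the track of the homotopy to the path. *)
Lemma mp_end_lifting : vertical_lifting R mp_end.
Proof.
move=> Z k H ck cH H0 Hp; have cev := mp_ev_cts.
pose u (z : (Z * unitI R) * unitI R) : E' :=
  if uval z.2 * (1 + uval z.1.2) - 1 <= 0
  then mp_ev (k z.1.1, clamp (uval z.2 * (1 + uval z.1.2)))
  else H (z.1.1, clamp (uval z.2 * (1 + uval z.1.2) - 1)).
have u_cts : continuous u.
  rewrite /u; apply: cts_if; [by cts..|] => -[[z s] t] /= st.
  have -> : uval t * (1 + uval s) = 1 by lra.
  by rewrite subrr (clamp0 (lexx 0)) (clamp1 (lexx 1)) H0.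
have e_cts : continuous (fun z : Z * unitI R => (set_val (k z.1)).1) by cts.
have u0 z : u (z, zero) = f (set_val (k z.1)).1.
  by rewrite /u /= val_zero mul0r ifT ?clamp0 ?mp_ev0 //; lra.
have up z t : fw_proj (u (z, t)) = fw_proj (set_val (k z.1)).1.
  by rewrite /u; case: ifP => _; rewrite ?mp_ev_proj ?Hp.
exists (mp_mk u_cts u0 up); first exact: mp_mk_cts.
split=> [z|[z s]].
  apply: mp_inj => // t; have ? := unitI_le1 t; rewrite {1}/mp_ev /= /curry /u /=.
  by rewrite val_zero addr0 mulr1 ifT ?clampK //; lra.
rewrite /= /mp_ev /= /curry /u /= val_one mul1r.
have ? := unitI_ge0 s; have ? := unitI_le1 s.
rewrite addrAC subrr add0r; case: ifPn => [s0|_]; last by rewrite clampK.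
have -> : s = zero by rewrite -[s]clampK clamp0.
by rewrite H0 val_zero addr0 clamp1.
Qed.

End MappingPathSpace.

(** * Gluing of local sections *)

Lemma cts_at_near (X Y : topologicalType) (f g : X -> Y) (x : X) :
  (\forall y \near x, f y = g y) -> {for x, continuous f} -> {for x, continuous g}.
Proof.
move=> fg cf; have fgx : f x = g x by exact: (nbhs_singleton fg).
rewrite /prop_for /continuous_at -fgx; apply: cvg_trans cf.
by apply: near_eq_cvg; near=> y; near: y.
Unshelve. all: by end_near. Qed.

Section Gluing.
Variables (R : realType) (W C : topologicalType) (q : W -> C).

Section Step.
Variables (mu lam : C -> R) (S : C -> W) (T : W * unitI R -> W) (s0 : C -> W).
Hypotheses (mu_cts : continuous mu) (lam_cts : continuous lam).
Hypotheses (mu_ge0 : forall x, 0 <= mu x) (lam_ge0 : forall x, 0 <= lam x).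
Hypothesis qS : forall x, q (S x) = x.
Hypothesis S_cts : forall x, 0 < mu x -> {for x, continuous S}.
Hypothesis T1 : forall w, T (w, one) = w.
Hypothesis T0 : forall w, 0 < lam (q w) -> T (w, zero) = T (s0 (q w), zero).
Hypothesis T_cts : forall w t, 0 < lam (q w) -> {for (w, t), continuous T}.
Hypothesis s_cts : forall x, 0 < lam x -> {for x, continuous (fun x => T (s0 x, zero))}.

Definition glue_time (x : C) : unitI R := clamp ((2 * mu x - lam x) / (mu x + lam x)).

(** The section [S] is continuous where [mu] is positive, and the local
    shrinking [T] where [lam] is.  Where both are, [T] deforms the section that
    it defines into [S].  The time is 0 where [mu] is small compared with [lam]
    and 1 where it is large, so that a section that may fail to be continuous
    is never used near the points in question. *)
Definition glue_step (x : C) : W :=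
  if lam x == 0 then S x else T (S x, glue_time x).

Lemma glue_step_cts x : 0 < mu x + lam x -> {for x, continuous glue_step}.
Proof.
move=> ml0.
have lam_gt0 y : lam y != 0 -> 0 < lam y by move=> ?; rewrite lt_def lam_ge0 andbT.
have near_gt0 (f : C -> R) : continuous f -> 0 < f x -> \forall y \near x, 0 < f y.
  by move=> cf fx; have := open_gt0 cf; rewrite openE => /(_ x fx).
have [l0|lN0] := eqVneq (lam x) 0.
  have m0 : 0 < mu x by move: ml0; rewrite l0 addr0.
  apply: cts_at_near (S_cts m0); rewrite /glue_step.
  have c2 : continuous (fun y => mu y - 2 * lam y) by cts.
  have : \forall y \near x, 0 < mu y - 2 * lam y by apply: near_gt0; rewrite // l0 mulr0 subr0.
  move=> nh; apply: filterS nh => y hy; case: eqVneq => // ly.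
  have := lam_gt0 y ly => ly0; have ? := mu_ge0 y.
  by rewrite /glue_time clamp1 ?T1 // ler_pdivlMr; lra.
have lx0 := lam_gt0 x lN0; have nl := near_gt0 lam lam_cts lx0.
have [m0|mN0] := eqVneq (mu x) 0.
  apply: cts_at_near (s_cts lx0).
  have c2 : continuous (fun y => lam y - 2 * mu y) by cts.
  have : \forall y \near x, 0 < lam y - 2 * mu y by apply: near_gt0; rewrite // m0 mulr0 subr0.
  move=> nh; apply: filterS2 nl nh => y ly hy; rewrite /glue_step gt_eqF //.
  have ? := mu_ge0 y; have -> : glue_time y = zero.
    by rewrite /glue_time clamp0 // ler_pdivrMr; lra.
  by rewrite (T0 (w := S y)) qS.
have mx0 : 0 < mu x by rewrite lt_def mN0 mu_ge0.
apply: (@cts_at_near _ _ (fun y => T (S y, glue_time y))).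
  by move: nl; apply: filterS => y ly; rewrite /glue_step gt_eqF.
apply: (@continuous_comp _ _ _ (fun y => (S y, glue_time y)) T).
  have c1 : {for x, continuous S} by exact: S_cts.
  suff c2 : {for x, continuous glue_time}.
    exact: (cvg_pair c1 c2).
  apply: (@continuous_comp _ _ _
    (fun x => (2 * mu x - lam x) / (mu x + lam x)) (@clamp R)); last first.
    exact: (cts_clamp (@cts_id R)).
  have c2 : continuous (fun y => 2 * mu y - lam y) by cts.
  have c3 : continuous (fun y => mu y + lam y) by cts.
  by apply: cvgM; [exact: c2|apply: cvgV; [rewrite gt_eqF|exact: c3]].
by apply: T_cts; rewrite qS.
Qed.

End Step.

Variables (J : choiceType) (lam : J -> C -> R) (T : J -> W * unitI R -> W).
Variable s0 : C -> W.
Hypothesis lam_cts : forall j, continuous (lam j).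
Hypothesis lam_ge0 : forall j x, 0 <= lam j x.
Hypothesis lam_finite : forall x : C, exists2 U : set C, nbhs x U &
  finite_set [set j | exists2 y, U y & lam j y != 0].
Hypothesis lam_cover : forall x : C, exists j, 0 < lam j x.
Hypothesis qs0 : forall x, q (s0 x) = x.
Hypothesis qT : forall j w t, q (T j (w, t)) = q w.
Hypothesis T1 : forall j w, T j (w, one) = w.
Hypothesis T0 : forall j w, 0 < lam j (q w) -> T j (w, zero) = T j (s0 (q w), zero).
Hypothesis T_cts : forall j w t, 0 < lam j (q w) -> {for (w, t), continuous (T j)}.
Hypothesis s_cts : forall j x, 0 < lam j x ->
  {for x, continuous (fun x => T j (s0 x, zero))}.

(** The tail of the list is processed first, and [s0] is only a placeholder:
    the first step with a positive function discards it. *)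
Fixpoint glue (l : seq J) : C -> W :=
  if l is j :: l' then
    glue_step (fun x => \sum_(i <- l') lam i x) (lam j) (glue l') (T j)
  else s0.

Lemma q_glue l x : q (glue l x) = x.
Proof.
elim: l => [|j l IH] /=; first exact: qs0.
by rewrite /glue_step; case: ifP; rewrite ?qT.
Qed.

Lemma sum_lam_cts l : continuous (fun x => \sum_(i <- l) lam i x).
Proof.
elim: l => [|j l IH].
  by under eq_fun do rewrite big_nil; exact: cts_cst.
under eq_fun do rewrite big_cons.
by apply: cts_add.
Qed.

Lemma sum_lam_ge0 l x : 0 <= \sum_(i <- l) lam i x.
Proof. by apply: sumr_ge0 => i _; exact: lam_ge0. Qed.

Lemma glue_cts l x : 0 < \sum_(i <- l) lam i x -> {for x, continuous (glue l)}.
Proof.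
elim: l x => [|j l IH] x; first by rewrite big_nil ltxx.
rewrite big_cons addrC => h; apply: (glue_step_cts (s0 := s0)) => //.
- exact: sum_lam_cts.
- exact: sum_lam_ge0.
- exact: q_glue.
- exact: T0.
- exact: T_cts.
- exact: s_cts.
Qed.

Lemma glue_filter l x : glue [seq j <- l | lam j x != 0] x = glue l x.
Proof.
elim: l => [//|j l IH] /=; case: ifPn => [jx|]; last first.
  by rewrite negbK => /eqP jx; rewrite /glue_step jx eqxx.
rewrite /= /glue_step /glue_time (negbTE jx) IH.
congr (T j (_, clamp ((2 * _ - _) / (_ + _)))).
  by rewrite big_filter [RHS](bigID (fun j => lam j x != 0)) /= [X in _ + X]big1
    ?addr0 // => i; rewrite negbK => /eqP.
by rewrite big_filter [RHS](bigID (fun j => lam j x != 0)) /= [X in _ + X]big1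
  ?addr0 // => i; rewrite negbK => /eqP.
Qed.

(** At each point, apply the steps of the finitely many indices available there,
    in a fixed total order.  The steps of the other indices change nothing, so
    that near a point a single finite list of indices gives the section. *)
Lemma glue_section : exists2 S : C -> W, continuous S & forall x, q (S x) = x.
Proof.
have [r wo] := well_ordering_principle J.
have rT : wo_chain r predT by move=> A _; exact: wo.
have r_total : total r by move=> x y; exact: (wo_chainW rT).
have r_anti : antisymmetric r by move=> x y; exact: (wo_chain_antisymmetric rT).
have r_trans : transitive r.
  move=> y x z xy yz; have [|m [[mA lb] _]] := wo [pred u | u \in [:: x; y; z]].
    by exists x; rewrite !inE eqxx.
  have lx : r m x by apply: lb; rewrite !inE eqxx.
  have ly : r m y by apply: lb; rewrite !inE eqxx orbT.
  have lz : r m z by apply: lb; rewrite !inE eqxx !orbT.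
  move: mA lx ly lz; rewrite !inE => /or3P[] /eqP -> // lx ly lz.
    by rewrite (r_anti x y) // xy lx.
  by rewrite -(r_anti y z) // yz ly.
pose supp x := [set j | lam j x != 0].
have fin x : finite_set (supp x).
  have [U Ux] := lam_finite x; apply: sub_finite_set => j jx.
  by exists x => //; exact: nbhs_singleton.
pose S x := glue (sort r (fset_set (supp x))) x.
exists S => [x|x]; last exact: q_glue.
have [U Ux finU] := lam_finite x.
set F := [set j | _] in finU.
pose l := sort r (fset_set F).
have Sl y : U y -> S y = glue l y.
  move=> Uy; rewrite -(glue_filter l) /S; congr (glue _ y).
  apply: (@sorted_eq _ r) => //.
  - exact: sort_sorted.
  - by apply: sorted_filter => //; exact: sort_sorted.
  apply: uniq_perm; rewrite ?sort_uniq ?filter_uniq ?sort_uniq ?fset_uniq // => j.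
  rewrite mem_filter !mem_sort !in_fset_set //.
  apply/idP/andP => [/set_mem jy|[jy _]]; last exact: mem_set.
  by split; [exact: jy|apply: mem_set; exists y].
apply: (@cts_at_near _ _ (glue l)).
  by move: Ux; apply: filterS => y /Sl.
apply: glue_cts; have [j jx] := lam_cover x.
have jl : j \in l.
  rewrite mem_sort in_fset_set //; apply: mem_set; exists x; first exact: nbhs_singleton.
  by rewrite gt_eqF.
rewrite (bigD1_seq j) /= ?sort_uniq ?fset_uniq //.
by apply: ltr_wpDr => //; apply: sumr_ge0 => i _; exact: lam_ge0.
Qed.

End Gluing.

(** * The theorem of Dold *)

Lemma cts_at_open (X Y : topologicalType) (O : set X) (g : X -> Y) (x : X) :
  open O -> continuous (fun z : set_type O => g (set_val z)) -> O x ->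
  {for x, continuous g}.
Proof.
move=> oO cg Ox.
have : {within O, continuous g} by apply/subspace_sigL_continuousP.
by rewrite continuous_open_subspace // => /(_ x); apply; exact: mem_set.
Qed.

Section OpenRestriction.
Variables (R : realType) (B : topologicalType) (O : set B) (W : fwSpace B).
Notation a := (set_val : set_type O -> B).

Definition over_mk (w : W) (H : O (fw_proj w)) : pb a W :=
  @pb_mk B (set_type O) a W (exist (fun b => b \in O) _ (mem_set H)) w erefl.

Lemma over_mk_cts (Z : topologicalType) (h : Z -> W)
    (H : forall z, O (fw_proj (h z))) :
  continuous h -> continuous (fun z => over_mk (H z)).
Proof.
move=> ch; apply: pb_cts; last exact: ch.
by apply: cts_sub; exact: (cts_comp (fw_proj_cts W) ch).
Qed.

End OpenRestriction.

(** The shrinking of the pullback to [O], extended by the identity.  The last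
    clause provides the section over [O]: it is the time 0 of the shrinking,
    applied to an arbitrary choice of points. *)
Lemma local_shrinking (R : realType) (B : topologicalType) (W C : fwSpace B)
    (q : fwMap W C) (O : set B) :
  open O -> vertical_lifting R q ->
  fw_homotopy_equiv R (pb_map (set_val : set_type O -> B) q) ->
  exists T : W * unitI R -> W,
    [/\ forall w t, q (T (w, t)) = q w, forall w, T (w, one) = w,
        forall w w', O (fw_proj w) -> q w = q w' -> T (w, zero) = T (w', zero),
        forall w t, O (fw_proj w) -> {for (w, t), continuous T} &
        (forall c, O (fw_proj c) -> exists w, q w = c) /\
        forall (s0 : C -> W) c, (forall c, q (s0 c) = c) -> O (fw_proj c) ->
          {for c, continuous (fun c => T (s0 c, zero))}].
Proof.
move=> oO /(vertical_lifting_pb (a := (set_val : set_type O -> B))) lq eq.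
have [s [T [cT qs qT T0 T1]]] := shrinkable lq eq.
pose T' (z : W * unitI R) : W := if pselect (O (fw_proj z.1)) is left H
  then (set_val (T (over_mk H, z.2))).2 else z.1.
have T'E w t (H : O (fw_proj w)) : T' (w, t) = (set_val (T (over_mk H, t))).2.
  by rewrite /T' /=; case: pselect => // H'; rewrite (Prop_irrelevance H H').
have qE w (H : O (fw_proj w)) (H' : O (fw_proj (q w))) :
    pb_map set_val q (over_mk H) = over_mk H'.
  by apply: pb_inj => //; apply: val_inj; rewrite /= fw_fun_proj.
exists T'; split.
- move=> w t; rewrite /T' /=; case: pselect => // H.
  by have /(congr1 (fun z => (set_val z).2)) := qT (over_mk H) t.
- by move=> w; rewrite /T' /=; case: pselect => // H; rewrite T1.
- move=> w w' H qw; have H' : O (fw_proj w') by rewrite -(fw_fun_proj q) -qw fw_fun_proj.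
  rewrite (T'E _ _ H) (T'E _ _ H') !T0; congr (_ (set_val (s _))).2.
  by apply: pb_inj => /=; [apply: val_inj; rewrite /= -!(fw_fun_proj q) qw|].
- move=> w t H; apply: (@cts_at_open _ _ [set z | O (fw_proj z.1)]) => //.
    have c : continuous (fun z : W * unitI R => fw_proj z.1) by cts.
    by apply: open_comp => // x _; exact: c.
  have mem (z : [set z : W * unitI R | O (fw_proj z.1)]) :
      O (fw_proj (set_val z).1) by exact: (set_valP z).
  apply: (@eq_cts _ _ (fun z => (set_val (T (over_mk (mem z), (set_val z).2))).2)).
    by move=> z; rewrite -T'E -surjective_pairing.
  have c := @over_mk_cts B O W _
    (fun z : [set z : W * unitI R | O (fw_proj z.1)] => (set_val z).1) mem.
  apply: cts_snd; apply: cts_val; apply: (cts_comp cT); apply: cts_pair; last by cts.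
  by apply: c; cts.
split=> [c H|s0 c qs0 H].
  exists (set_val (s (over_mk H))).2.
  by have /(congr1 (fun z => (set_val z).2)) := qs (over_mk H).
apply: (@cts_at_open _ _ [set c | O (fw_proj c)]) => //.
  by apply: open_comp => // x _; exact: fw_proj_cts.
have mem (z : [set c : C | O (fw_proj c)]) : O (fw_proj (set_val z)) by exact: (set_valP z).
apply: (@eq_cts _ _ (fun z => (set_val (s (over_mk (mem z)))).2)).
  move=> z; have H' : O (fw_proj (s0 (set_val z))) by rewrite -(fw_fun_proj q) qs0.
  rewrite (T'E _ _ H') T0; congr (_ (set_val (s _))).2.
  apply: pb_inj; rewrite /= ?qs0 //.
  by apply: val_inj; rewrite /= -[in RHS](fw_fun_proj q) qs0.
have c' := @over_mk_cts B O C _ (fun z : [set c : C | O (fw_proj c)] => set_val z) mem.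
apply: cts_snd; apply: cts_val; apply: (cts_comp (fw_fun_cts s)).
by apply: c'; cts.
Qed.

Section Dold.
Variables (R : realType) (B : topologicalType).
Variables (J : choiceType) (lam : J -> B -> R).
Hypothesis lam_cts : forall j, continuous (lam j).
Hypothesis lam_ge0 : forall j x, 0 <= lam j x.
Hypothesis lam_finite : forall x : B, exists2 U : set B, nbhs x U &
  finite_set [set j | exists2 y, U y & lam j y != 0].
Hypothesis lam_cover : forall x : B, exists j, 0 < lam j x.
Notation a j := (set_val : set_type [set b | 0 < lam j b] -> B).

(** The end point map of the mapping path space is locally shrinkable, because
    it is a fibration and locally an equivalence; so it has a section. *)
Lemma local_right_inverse (E E' : fwSpace B) (f : fwMap E E') :
  (forall j, fw_homotopy_equiv R (pb_map (a j) f)) ->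
  exists g : fwMap E' E, fw_homotopic R (fw_comp f g) (fw_id E').
Proof.
move=> flocal; pose q := mp_end R f.
have qlocal j : fw_homotopy_equiv R (pb_map (a j) q).
  apply: (fhe_homotopic (fwh_sym (pb_homotopic (a j) (mp_end_homotopic R f)))).
  apply: fhe_homotopic (fhe_comp (flocal j) (pb_fhe (a j) (mp_start_fhe R f))).
  by apply: fwh_refl => z; exact: pb_inj.
have oO j : open [set b | 0 < lam j b] by exact: open_gt0.
have [T HT] :=
  choice (fun j => local_shrinking (oO j) (@mp_end_lifting R B E E' f) (qlocal j)).
have [s0 qs0] : {s0 : E' -> mp R f & forall c, q (s0 c) = c}.
  apply: (@choice _ _ (fun c w => q w = c)) => c.
  have [j jc] := lam_cover (fw_proj c).
  by have [_ _ _ _ [+ _]] := HT j; apply.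
have [S cS qS] : exists2 S : E' -> mp R f, continuous S & forall x, q (S x) = x.
  apply: (@glue_section R _ _ q J (fun j c => lam j (fw_proj c)) T s0) => //.
  - by move=> j; have c : continuous (lam j) := @lam_cts j; cts.
  - move=> c; have [U Uc finU] := lam_finite (fw_proj c).
    exists ((@fw_proj B E') @^-1` U); first exact: (fw_proj_cts E' c).
    apply: sub_finite_set finU => j [y Uy ly]; by exists (fw_proj y).
  - by move=> j w t; have [+ _ _ _ _] := HT j; apply.
  - by move=> j w; have [_ + _ _ _] := HT j; apply.
  - by move=> j w ?; have [_ _ + _ _] := HT j; apply; rewrite ?qs0 // -(fw_fun_proj q).
  - by move=> j w t ?; have [_ _ _ + _] := HT j; apply; rewrite -(fw_fun_proj q).
  - by move=> j c ?; have [_ _ _ _ [_ +]] := HT j; apply.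
have gp x : fw_proj (mp_start R f (S x)) = fw_proj x.
  by rewrite fw_fun_proj -[LHS](fw_fun_proj q) qS.
have gc : continuous (fun x => mp_start R f (S x)) by cts.
exists (FwMap gc gp); have cev := @mp_ev_cts R B E E' f.
apply: (@fwhI R B E' E' _ _ (fun z => mp_ev (S z.1, z.2))).
- by cts.
- by move=> x t; rewrite mp_ev_proj -[LHS](fw_fun_proj q) qS.
- by move=> x; rewrite mp_ev0.
- by move=> x; exact: qS.
Qed.

(** Dold's theorem.  A right inverse of [f] is itself locally an equivalence,
    hence has a right inverse in turn, and so is an equivalence. *)
Theorem dold_local (E E' : fwSpace B) (f : fwMap E E') :
  (forall j, fw_homotopy_equiv R (pb_map (a j) f)) -> fw_homotopy_equiv R f.
Proof.
move=> flocal; have [g fg] := local_right_inverse flocal.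
have [|h gh] := @local_right_inverse _ _ g.
  move=> j; apply: (fhe_inv (flocal j)).
  apply: (fwh_trans _ (fwh_trans (pb_homotopic (a j) fg) _)).
    by apply: fwh_refl => z; exact: pb_inj.
  by apply: fwh_refl => z; exact: pb_inj.
have g_fhe : fw_homotopy_equiv R g by exact: fhe_lr fg gh.
apply: (fhe_cancel_r g_fhe); apply: (fhe_homotopic (fwh_sym fg)).
exact: (@fhe_iso R B E' E' (fw_id E') (fw_id E')).
Qed.

End Dold.

(** * Transport in Hurewicz fibrations *)

Section Transport.
Variables (R : realType) (B : topologicalType).
Implicit Types E : fwSpace B.

(** Run back along the first lift and then along the second: the projection of
    this path runs forth and back along itself. *)
Lemma lifts_unique E (Z : topologicalType) (L L' : Z * unitI R -> E) :
  hurewicz_fibration R E -> continuous L -> continuous L' ->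
  (forall z, L (z, zero) = L' (z, zero)) ->
  (forall z, fw_proj (L z) = fw_proj (L' z)) ->
  exists D : Z * unitI R -> E,
    [/\ continuous D, forall z, D (z, zero) = L (z, one),
        forall z, D (z, one) = L' (z, one) &
        forall z t, fw_proj (D (z, t)) = fw_proj (L (z, one))].
Proof.
move=> hE cL cL' L0 pL; pose M := hcat (hrev L) L'.
have cM : continuous M.
  by apply: cts_hcat => // [|z]; [exact: cts_hrev|rewrite hrev1].
have pM x t : fw_proj (M (x, clamp (1 - uval t))) = fw_proj (M (x, t)).
  have ? := unitI_ge0 t; have ? := unitI_le1 t.
  rewrite /M /hcat /hrev /= clamp_id; [|lra..].
  case: (ltrgtP (2 * uval t - 1) 0) => ht.
  - rewrite ifF; last by apply/negbTE; rewrite -ltNge; lra.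
    by rewrite -pL clamp_id; [congr (fw_proj (L (_, clamp _)))|..]; lra.
  - rewrite ifT; last by lra.
    by rewrite -pL clamp_id; [congr (fw_proj (L (_, clamp _)))|..]; lra.
  - rewrite ifT; last by lra.
    by congr (fw_proj (L (_, clamp (1 - uval (clamp _))))); lra.
have [|D [cD D0 D1 pD]] := @palindrome_vertical R E B (@fw_proj B E) Z M.
  have [||z|K [cK K0 pK]] := hE (Z * unitI R)%type M (@retrace R E B (@fw_proj B E) Z M).
  - exact: cM.
  - by apply: cts_retrace => //; exact: fw_proj_cts.
  - by exact: (retrace0 pM z).
  - by exists K.
exists D; split => //.
- by move=> z; rewrite D0 /M hcat0 hrev0.
- by move=> z; rewrite D1 /M hcat1.
- by move=> z t; rewrite pD /M hcat0 hrev0.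
Qed.

Variable A : topologicalType.
Implicit Types (a : A -> B) (H : A * unitI R -> B).

(** [T] moves points along the tracks of the homotopy [H] from [a] to [a']. *)
Definition is_transport a a' H E (T : fwMap (pb a E) (pb a' E)) : Prop :=
  exists2 L : pb a E * unitI R -> E, continuous L &
    [/\ forall z, L (z, zero) = (set_val z).2,
        forall z, L (z, one) = (set_val (T z)).2 &
        forall z t, fw_proj (L (z, t)) = H (fw_proj z, t)].

Section Homotopy.
Variables (a a' : A -> B) (H : A * unitI R -> B).
Hypotheses (H_cts : continuous H).
Hypotheses (H0 : forall c, H (c, zero) = a c) (H1 : forall c, H (c, one) = a' c).

Lemma transport_exists E : hurewicz_fibration R E ->
  exists T : fwMap (pb a E) (pb a' E), is_transport H T.
Proof.
move=> hE; have [|||L [cL L0 pL]] :=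
  hE (pb a E) (fun z => (set_val z).2) (fun z => H (fw_proj z.1, z.2)).
- by cts.
- by cts.
- by move=> z; rewrite H0 pb_eq.
have mem z : fw_proj (L (z, one)) = a' (fw_proj z) by rewrite pL H1.
have T_cts : continuous (fun z => pb_mk (mem z)) by apply: pb_cts; cts.
by exists (@FwMap A (pb a E) (pb a' E) _ T_cts (fun=> erefl)); exists L.
Qed.

Lemma transport_natural E E' (f : fwMap E E')
    (T : fwMap (pb a E) (pb a' E)) (T' : fwMap (pb a E') (pb a' E')) :
  hurewicz_fibration R E' -> is_transport H T -> is_transport H T' ->
  fw_homotopic R (fw_comp (pb_map a' f) T) (fw_comp T' (pb_map a f)).
Proof.
move=> hE' [L cL [L0 L1 pL]] [L' cL' [L'0 L'1 pL']].
have [|||z|D [cD D0 D1 pD]] := @lifts_unique E' (pb a E) (fun z => f (L z))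
  (fun z => L' (pb_map a f z.1, z.2)) hE'.
- by cts.
- by cts.
- by move=> z; rewrite L0 L'0.
- by case: z => z t; rewrite fw_fun_proj pL pL'.
have mem z : fw_proj (D z) = a' (fw_proj z.1).
  by case: z => z t; rewrite pD fw_fun_proj pL H1.
apply: (@fwhI R A (pb a E) (pb a' E') _ _ (fun z => pb_mk (mem z))) => //.
- by apply: pb_cts; cts.
- move=> z; apply: pb_inj; last by rewrite /= D0 L1.
  by rewrite [RHS]fw_fun_proj.
- move=> z; apply: pb_inj; last by rewrite /= D1 L'1.
  by rewrite [RHS]fw_fun_proj.
Qed.

End Homotopy.

Lemma transport_cancel a a' H H' E
    (T : fwMap (pb a E) (pb a' E)) (T' : fwMap (pb a' E) (pb a E)) :
  hurewicz_fibration R E -> (forall c, H (c, zero) = a c) ->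
  (forall c t, H' (c, t) = H (c, clamp (1 - uval t))) ->
  is_transport H T -> is_transport H' T' ->
  fw_homotopic R (fw_comp T' T) (fw_id (pb a E)).
Proof.
move=> hE H0 HH' [L cL [L0 L1 pL]] [L' cL' [L'0 L'1 pL']].
have [|||z|D [cD D0 D1 pD]] := @lifts_unique E (pb a E)
   (hrev L) (fun z => L' (T z.1, z.2)) hE.
- exact: cts_hrev.
- by cts.
- by move=> z; rewrite hrev0 L1 L'0.
- by case: z => z t; rewrite /hrev pL pL' HH' fw_fun_proj.
have mem z : fw_proj (D z) = a (fw_proj z.1).
  by case: z => z t; rewrite pD hrev1 L0 pb_eq.
apply: fwh_sym.
apply: (@fwhI R A (pb a E) (pb a E) _ _ (fun z => pb_mk (mem z))) => //.
- by apply: pb_cts; cts.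
- by move=> z; apply: pb_inj => //=; rewrite D0 hrev1 L0.
- move=> z; apply: pb_inj; last by rewrite /= D1 L'1.
  by rewrite [RHS]fw_fun_proj.
Qed.

Lemma transport_fhe a a' H E (T : fwMap (pb a E) (pb a' E)) :
  hurewicz_fibration R E -> continuous H ->
  (forall c, H (c, zero) = a c) -> (forall c, H (c, one) = a' c) ->
  is_transport H T -> fw_homotopy_equiv R T.
Proof.
move=> hE cH H0 H1 HT.
have r0 c : hrev H (c, zero) = a' c by rewrite hrev0.
have r1 c : hrev H (c, one) = a c by rewrite hrev1.
have [T' HT'] := transport_exists (cts_hrev cH) r0 r1 hE.
exists T'; split; first exact: (transport_cancel hE H0 _ HT HT').
apply: (transport_cancel hE r0 _ HT' HT) => c t.
have ? := unitI_ge0 t; have ? := unitI_le1 t.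
rewrite /hrev /= clamp_id; [|lra..].
by rewrite (_ : 1 - (1 - uval t) = uval t) ?clampK //; lra.
Qed.

(** Transport along the tracks of the homotopy is an equivalence, and commutes
    with [f] up to homotopy. *)
Lemma pb_fhe_homotopy a a' H E E' (f : fwMap E E') :
  hurewicz_fibration R E -> hurewicz_fibration R E' -> continuous H ->
  (forall c, H (c, zero) = a c) -> (forall c, H (c, one) = a' c) ->
  fw_homotopy_equiv R (pb_map a' f) -> fw_homotopy_equiv R (pb_map a f).
Proof.
move=> hE hE' cH H0 H1.
have [T HT] := transport_exists cH H0 H1 hE.
have [T' HT'] := transport_exists cH H0 H1 hE'.
apply: (proj2 (fhe_conj (transport_fhe hE cH H0 H1 HT) (transport_fhe hE' cH H0 H1 HT') _)).
by apply: fwh_sym; exact: (transport_natural H1 f hE' HT HT').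
Qed.

End Transport.

(** * Disks *)

Section Disks.
Variables (R : realType) (n : nat).
Implicit Types y : 'rV[R]_n.

Definition sqsum y : R := \sum_i y 0 i ^+ 2.

Lemma sqsum_ge0 y : 0 <= sqsum y.
Proof. by apply: sumr_ge0 => i _; exact: sqr_ge0. Qed.

Lemma sqsumZ (c : R) y : sqsum (c *: y) = c ^+ 2 * sqsum y.
Proof. by rewrite /sqsum mulr_sumr; apply: eq_bigr => i _; rewrite mxE exprMn. Qed.

Lemma sqsum_cts : continuous sqsum.
Proof.
rewrite /sqsum; apply: continuous_big; first exact: add_continuous.
move=> i _; under eq_fun do rewrite expr2.
by apply: cts_mul; exact: coord_continuous.
Qed.

Lemma cdisk_compact : compact (cdisk R n).
Proof.
apply: (@subclosed_compact _ _ [set v : 'rV[R]_n | forall i, `[-1, 1]%classic (v ord0 i)]).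
- have c := sqsum_cts.
  have : closed [set y | sqsum y - 1 <= 0] by apply: closed_le0; cts.
  by congr closed; apply/seteqP; split => y /=; rewrite subr_le0.
- by apply: (@rV_compact R n (fun=> `[-1, 1]%classic)) => i; exact: segment_compact.
- move=> y /= y1 i; rewrite in_itv /= -ler_norml -(ler_pXn2r (n := 2)) ?nnegrE //.
  rewrite real_normK ?num_real // expr1n; apply: le_trans y1.
  by rewrite (bigD1 i) //= lerDl; apply: sumr_ge0 => j _; exact: sqr_ge0.
Qed.

Lemma cdiskP y : cdisk R n y <-> odisk R n y \/ bsphere R n y.
Proof.
rewrite /cdisk /odisk /bsphere /= le_eqVlt; split.
  by case/orP => [/eqP|]; [right|left].
by case=> [->|->]; rewrite ?orbT ?eqxx.
Qed.

Lemma cdiskZ (c : R) y : 0 <= c <= 1 -> cdisk R n y -> cdisk R n (c *: y).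
Proof.
move=> /andP[c0 c1]; rewrite /cdisk /= -!/(sqsum _) sqsumZ; apply: le_trans.
by rewrite ler_piMl ?sqsum_ge0 // exprn_ile1.
Qed.

(** The retraction of the cylinder over the disk onto its bottom and its side,
    by central projection from the point of height 2 above the centre of the
    disk.  The maximum singles out which of the two is hit, so that one formula
    covers both cases and is evidently continuous. *)
Definition rho_norm y (t : unitI R) : R :=
  Num.max (Num.sqrt (sqsum y)) (1 - 2^-1 * uval t).

Definition rho_time y t : unitI R := clamp (2 - (2 - uval t) / rho_norm y t).

Definition rho_pt y t : 'rV[R]_n := (rho_norm y t)^-1 *: y.

Lemma rho_norm_gt0 y t : 0 < rho_norm y t.
Proof. by have := unitI_le1 t; rewrite /rho_norm lt_max => ?; apply/orP; right; lra. Qed.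

Lemma rho_norm_cts : continuous (fun z : 'rV[R]_n * unitI R => rho_norm z.1 z.2).
Proof.
have c1 := sqsum_cts; have c2 := @sqrt_continuous R.
by rewrite /rho_norm; cts.
Qed.

Lemma rho_norm_inv_cts :
  continuous (fun z : 'rV[R]_n * unitI R => (rho_norm z.1 z.2)^-1).
Proof.
move=> z; apply: cvgV; first by rewrite gt_eqF // rho_norm_gt0.
exact: rho_norm_cts.
Qed.

Lemma rho_time_cts : continuous (fun z : 'rV[R]_n * unitI R => rho_time z.1 z.2).
Proof. by have c := rho_norm_inv_cts; rewrite /rho_time; cts. Qed.

Lemma rho_pt_cts : continuous (fun z : 'rV[R]_n * unitI R => rho_pt z.1 z.2).
Proof.
move=> z; apply: cvgZ; first exact: rho_norm_inv_cts.
exact: cvg_fst.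
Qed.

Lemma sqrt_sqsum_le1 y : cdisk R n y -> Num.sqrt (sqsum y) <= 1.
Proof. by move=> y1; rewrite -[leRHS]sqrtr1 ler_wsqrtr. Qed.

Lemma rho_norm0 y : cdisk R n y -> rho_norm y zero = 1.
Proof.
move=> /sqrt_sqsum_le1 y1; rewrite /rho_norm val_zero mulr0 subr0.
by rewrite (max_idPr _).
Qed.

Lemma rho_norm_sphere y t : bsphere R n y -> rho_norm y t = 1.
Proof.
move=> y1; have ? := unitI_ge0 t.
by rewrite /rho_norm [sqsum y]y1 sqrtr1 (max_idPl _) //; lra.
Qed.

Lemma rho0 y : cdisk R n y -> rho_pt y zero = y /\ rho_time y zero = zero.
Proof.
move=> Dy; rewrite /rho_pt /rho_time rho_norm0 // invr1 scale1r; split => //.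
by rewrite val_zero subr0 mulr1 subrr clamp0.
Qed.

Lemma rho_sphere y t : bsphere R n y -> rho_pt y t = y /\ rho_time y t = t.
Proof.
move=> Sy; rewrite /rho_pt /rho_time rho_norm_sphere // invr1 scale1r; split => //.
by rewrite mulr1 opprB addrC subrK clampK.
Qed.

Lemma rho_cdisk y t : cdisk R n (rho_pt y t).
Proof.
rewrite /cdisk /= -/(sqsum _) sqsumZ exprVn ler_pdivrMl ?exprn_gt0 ?rho_norm_gt0 //.
rewrite mulr1 -[leLHS]sqr_sqrtr ?sqsum_ge0 // ler_pXn2r ?nnegrE ?sqrtr_ge0 //.
  by rewrite /rho_norm le_max lexx.
exact/ltW/rho_norm_gt0.
Qed.

Lemma rho_target y t : rho_time y t = zero \/ bsphere R n (rho_pt y t).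
Proof.
have m0 := rho_norm_gt0 y t.
case: (leP (Num.sqrt (sqsum y)) (1 - 2^-1 * uval t)) => h.
  left; rewrite /rho_time; have E : rho_norm y t = 1 - 2^-1 * uval t.
    by rewrite /rho_norm (max_idPr h).
  rewrite clamp0 // subr_le0 ler_pdivlMr //.
  by rewrite E; lra.
right; have E : rho_norm y t = Num.sqrt (sqsum y) by rewrite /rho_norm (max_idPl (ltW h)).
rewrite /bsphere /= -/(sqsum _) sqsumZ E exprVn sqr_sqrtr ?sqsum_ge0 //.
by rewrite mulVf // gt_eqF // -sqrtr_gt0 -E.
Qed.

End Disks.

(** * The topology of CW complexes *)

Section CWTopology.
Variables (R : realType) (T : topologicalType) (J : choiceType) (dim : J -> nat).
Variable Phi : forall j, 'rV[R]_(dim j) -> T.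
Hypothesis cw : CW_structure Phi.
Notation D j := (cdisk R (dim j)).
Notation O j := (odisk R (dim j)).
Notation S j := (bsphere R (dim j)).

Definition cells (Q : set J) : set T := \bigcup_(j in Q) (@Phi j @` O j).

(** The skeleton of dimension [n - 1], so that the induction over skeleta can
    start from the empty set. *)
Definition sk (n : nat) : set T := cells [set j | (dim j < n)%N].

Lemma cell_eq j k (x : T) :
  (@Phi j @` O j) x -> (@Phi k @` O k) x -> j = k.
Proof. by move=> jx kx; apply: (cw_disjoint cw) => //; exists x. Qed.

Lemma cells_all : cells [set: J] = [set: T].
Proof. exact: (cw_cover cw). Qed.

Lemma sphere_sk j y : S j y -> sk (dim j) (@Phi j y).
Proof.
move=> Sy; have [F [_ Fd FS]] := cw_closure_finite cw j.
by have [k Fk kx] := FS _ (imageP _ Sy); exists k => //; exact: Fd.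
Qed.

Lemma skS m n : (m <= n)%N -> sk m `<=` sk n.
Proof. by move=> mn x [j /= jm jx]; exists j => //; exact: leq_trans mn. Qed.

Lemma disk_sk j y : D j y -> sk (dim j).+1 (@Phi j y).
Proof.
move=> /cdiskP[Oy|Sy]; first by exists j => //=; exists y.
by apply: skS (sphere_sk Sy).
Qed.

Lemma disk_cts j : continuous (fun y : set_type (D j) => Phi (set_val y)).
Proof. exact/subspace_sigL_continuousP/(cw_cts cw). Qed.

Lemma disk_closed j (A : set 'rV[R]_(dim j)) :
  closed A -> closed (@Phi j @` (D j `&` A)).
Proof.
move=> cA; apply: (compact_closed (cw_hausdorff cw)).
apply: continuous_compact.
  have DA : D j `&` A `<=` D j by move=> y [].
  exact: (continuous_subspaceW DA (cw_cts cw (j := j))).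
rewrite setIC; apply: subclosed_compact (@cdisk_compact R (dim j)) _ => [|y []//].
by apply: closedI => //; apply: compact_closed; [exact: norm_hausdorff|exact: cdisk_compact].
Qed.

(** Cells outside [Q] impose no condition: [A] meets the boundary of such a cell
    only, hence meets it within the closures of finitely many cells of [Q]. *)
Lemma closed_cells (A : set T) (Q : set J) : A `<=` cells Q ->
  (forall j, Q j -> closed (A `&` @Phi j @` D j)) -> closed A.
Proof.
move=> AQ Qcl.
have all_cl k : closed (A `&` @Phi k @` D k).
  have [Qk|nQk] := pselect (Q k); first exact: Qcl.
  have [F [finF Fd FS]] := cw_closure_finite cw k.
  have -> : A `&` @Phi k @` D k = (@Phi k @` D k) `&`
      \bigcup_(i in F `&` Q) (A `&` @Phi i @` D i).
    apply/seteqP; split => [x [Ax [y Dy yx]]|x [kx [i [_ _] [Ax _]]]] //.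
    split; first by exists y.
    have [j Qj jx] := AQ x Ax.
    move: Dy => /cdiskP[Oy|Sy].
      by exfalso; apply: nQk; rewrite (@cell_eq k j x) //; exists y.
    have [i Fi ix] := FS x (ex_intro2 _ _ y Sy yx).
    have ij := cell_eq ix jx; exists i; first by split => //; rewrite ij.
    by split => //; case: ix => z Oz zx; exists z => //; apply/cdiskP; left.
  apply: closedI; first by have := @disk_closed k setT closedT; rewrite setIT.
  apply: closed_bigcup; first exact: finite_setIl.
  by move=> i [_ Qi]; exact: Qcl.
apply: (cw_weak cw) => j.
have -> : A `&` closure (@Phi j @` O j) =
    (A `&` @Phi j @` D j) `&` closure (@Phi j @` O j).
  rewrite -setIA; congr (A `&` _); apply/esym/setIidPr.
  have cD : closed (@Phi j @` D j) by have := @disk_closed j setT closedT; rewrite setIT.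
  rewrite [X in _ `<=` X](proj1 (closure_id _) cD); apply: closure_subset.
  by apply: image_subset => y Oy; apply/cdiskP; left.
by apply: closedI => //; exact: closed_closure.
Qed.

(** The preimage of a closed set meets each closed cell in the image of a
    compact subset of the disk. *)
Lemma cells_cts (Z : topologicalType) (Q : set J) (g : T -> Z) :
  (forall j, Q j -> forall y, D j y -> cells Q (@Phi j y)) ->
  (forall j, Q j -> continuous (fun y : set_type (D j) => g (Phi (set_val y)))) ->
  continuous (fun x : set_type (cells Q) => g (set_val x)).
Proof.
move=> QD gc; apply/continuous_closedP => F cF.
have clA : closed (cells Q `&` g @^-1` F).
  apply: (@closed_cells _ Q) => [x []//|j Qj].
  have /continuous_closedP/(_ F cF) : {within D j, continuous (g \o @Phi j)}.
    exact/subspace_sigL_continuousP/gc.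
  rewrite -closed_setSI; last first.
    by apply: compact_closed; [exact: norm_hausdorff|exact: cdisk_compact].
  move=> /disk_closed; congr closed; apply/seteqP; split => x.
    case=> y [Dy [_ Fy]] <-; split; last by exists y.
    by split=> //; exact: QD.
  by case=> [[_ Fx] [y Dy yx]]; exists y => //; subst x.
have -> : (fun x : set_type (cells Q) => g (set_val x)) @^-1` F =
    set_val @^-1` (cells Q `&` g @^-1` F).
  by apply/seteqP; split => [x Fx|x [_ Fx]] //; split => //; exact: set_valP.
apply: closed_comp => // x _; exact: (cts_val (@cts_id (set_type (cells Q)))).
Qed.

(** The exponential law turns homotopies into maps to a path space, for which
    continuity is tested on closed disks. *)
Lemma cells_cts_cylinder (Y : topologicalType) (Q : set J)
    (g : T -> unitI R -> Y) :
  (forall j, Q j -> forall y, D j y -> cells Q (@Phi j y)) ->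
  (forall j, Q j -> continuous (fun z : set_type (D j) * unitI R =>
     g (Phi (set_val z.1)) z.2)) ->
  continuous (fun z : set_type (cells Q) * unitI R => g (set_val z.1) z.2).
Proof.
move=> QD gc.
have -> : (fun z : set_type (cells Q) * unitI R => g (set_val z.1) z.2) =
    uncurry (fun x : set_type (cells Q) => g (set_val x)) by apply/funext => -[].
apply: continuous_uncurry.
- exact: unitI_locally_compact.
- exact: unitI_hausdorff.
- apply: (@cells_cts {compact-open, unitI R -> Y} Q g QD) => j Qj.
  by have [] := continuous_curry (gc j Qj).
- move=> x; have [j Qj [y Oy yx]] := set_valP x.
  have Dy : D j y by apply/cdiskP; left.
  have [_ /(_ (exist (fun y => y \in cdisk R (dim j)) y (mem_set Dy)))] :=
    continuous_curry (gc j Qj).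
  by rewrite /curry /= yx.
Qed.

Lemma sk_disk n j : (dim j < n)%N -> forall y, D j y -> sk n (@Phi j y).
Proof. by move=> jn y /disk_sk; exact: skS. Qed.

(** Open cells are embedded, so that coordinates on them are continuous. *)
Lemma cell_coord_cts j (c : T -> 'rV[R]_(dim j)) :
  (forall y, O j y -> c (@Phi j y) = y) ->
  continuous (fun x : set_type (@Phi j @` O j) => c (set_val x)).
Proof.
move=> cK; apply/continuousP => U oU.
have [V oV VU] := cw_homeo cw oU.
have -> : (fun x : set_type (@Phi j @` O j) => c (set_val x)) @^-1` U =
    set_val @^-1` V.
  apply/seteqP; split => x; have [y Oy yx] := set_valP x => Hx;
    have {}yx : set_val x = Phi y := esym yx.
    have : U (c (set_val x)) := Hx; rewrite yx cK // => Uy.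
    suff : V (set_val x) by []; rewrite yx; have : (@Phi j @` (O j `&` U)) (Phi y) by exists y.
    by rewrite VU => -[].
  have : V (set_val x) := Hx; rewrite yx => Vy.
  suff : U (c (set_val x)) by []; rewrite yx cK //.
  have : (@Phi j @` O j `&` V) (Phi y) by split => //; exists y.
  rewrite -VU => -[y' [Oy' Uy'] yy']; suff <- : y' = y by [].
  by apply: (cw_inj cw _ _ yy'); exact: mem_set.
apply: open_comp => // x _; exact: (cts_val (@cts_id (set_type (@Phi j @` O j)))).
Qed.

(** The other cells of the skeleton form a closed set. *)
Lemma top_cell_open n j : dim j = n ->
  exists2 V, open V & sk n.+1 `&` V = @Phi j @` O j.
Proof.
move=> jn; exists (~` (cells [set k | (dim k < n.+1)%N /\ k <> j])).
  apply: closed_openC; apply: (@closed_cells _ _ (fun x h => h)) => k [kn kj].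
  have -> : cells [set k | (dim k < n.+1)%N /\ k <> j] `&` @Phi k @` D k =
      @Phi k @` (D k `&` setT).
    rewrite setIT; apply/seteqP; split => [x []//|x [y Dy <-]]; split; last by exists y.
    move: Dy => /cdiskP[Oy|Sy]; first by exists k => //; exists y.
    have [i /= ik ix] := sphere_sk Sy; exists i => //; split.
      exact: leq_trans ik (ltnW kn).
    by move=> ij; move: ik; rewrite ij jn ltnNge -ltnS kn.
  exact: (disk_closed closedT).
apply/seteqP; split => [x [[k kn kx] nx]|x jx].
  have [<-//|kj] := pselect (k = j).
  by exfalso; apply: nx; exists k.
split; first by exists j => //=; rewrite jn.
by case=> k [_ kj] kx; apply: kj; exact: cell_eq kx jx.
Qed.

End CWTopology.

(** * Neighbourhoods of skeleta *)

Section CWRetraction.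
Variables (R : realType) (T : topologicalType) (J : choiceType) (dim : J -> nat).
Variable Phi : forall j, 'rV[R]_(dim j) -> T.
Hypothesis cw : CW_structure Phi.
Notation D j := (cdisk R (dim j)).
Notation O j := (odisk R (dim j)).
Notation S j := (bsphere R (dim j)).
Notation sk := (sk Phi).
Notation cells := (cells Phi).

Lemma cell_exists (x : T) : exists c : {j : J & 'rV[R]_(dim j)},
  O (tag c) (tagged c) /\ @Phi (tag c) (tagged c) = x.
Proof.
have : cells setT x by rewrite (cells_all cw).
by case=> j _ [y Oy yx]; exists (existT _ j y).
Qed.

Definition cell (x : T) : {j : J & 'rV[R]_(dim j)} := projT1 (cid (cell_exists x)).

Lemma cell_open x : O (tag (cell x)) (tagged (cell x)).
Proof. by rewrite /cell; case: cid => c []. Qed.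

Lemma cellK x : @Phi (tag (cell x)) (tagged (cell x)) = x.
Proof. by rewrite /cell; case: cid => c []. Qed.

Lemma cell_Phi j y : O j y -> cell (@Phi j y) = existT _ j y.
Proof.
move=> Oy; have := cellK (Phi y); have := cell_open (Phi y).
case: (cell (Phi y)) => k z /= Oz zy.
have kj : k = j by apply: (cell_eq cw (x := Phi y)); [exists z|exists y].
subst k; congr existT; apply: (cw_inj cw _ _ zy); exact: mem_set.
Qed.

Definition cdim x : nat := dim (tag (cell x)).

Lemma sk_cdim n x : sk n x <-> (cdim x < n)%N.
Proof.
split=> [|xn]; last first.
  exists (tag (cell x)) => //.
  by exists (tagged (cell x)); [exact: cell_open|exact: cellK].
by move=> [j /= jn [y Oy <-]]; rewrite /cdim cell_Phi.
Qed.

Section Fixed.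
Variable n : nat.

(** The retraction of the cylinder onto its bottom and the part over the
    skeleton [sk n]: over each further cell, first project the cylinder over
    the disk to its bottom and side, then apply the retraction constructed
    over the cells of smaller dimension. *)
Fixpoint retr (m : nat) (x : T) (t : unitI R) : T * unitI R :=
  if m is m'.+1 then
    if (cdim x == m') && (n <= m')%N then
      retr m' (Phi (rho_pt (tagged (cell x)) t)) (rho_time (tagged (cell x)) t)
    else retr m' x t
  else (x, t).

Lemma cell_cdisk x : D (tag (cell x)) (tagged (cell x)).
Proof. by apply/cdiskP; left; exact: cell_open. Qed.

Lemma retr0 m x : retr m x zero = (x, zero).
Proof.
elim: m x => [//|m IH] x /=; case: ifP => _; last exact: IH.
by have [-> ->] := rho0 (cell_cdisk x); rewrite cellK.
Qed.

Lemma retr_sk m x t : sk n x -> retr m x t = (x, t).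
Proof.
move=> /sk_cdim xn; elim: m => [//|m IH] /=; case: ifP => // /andP[/eqP xm].
by rewrite -xm leqNgt xn.
Qed.

Lemma retr_stable m k x t : sk m x -> (m <= k)%N -> retr k x t = retr m x t.
Proof.
move=> /sk_cdim xm; elim: k => [|k IH]; first by rewrite leqn0 => /eqP ->.
rewrite leq_eqVlt => /predU1P[<- //|mk] /=; case: ifP => [/andP[/eqP xk _]|_]; last exact: IH.
by have := leq_trans xm (mk : (m <= k)%N); rewrite xk ltnn.
Qed.

Lemma retr_cell m j (y : 'rV[R]_(dim j)) t : dim j = m -> D j y -> (n <= m)%N ->
  retr m.+1 (Phi y) t = retr m (Phi (rho_pt y t)) (rho_time y t).
Proof.
move=> <- /cdiskP[Oy|Sy] nj /=; first by rewrite /cdim cell_Phi // eqxx nj.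
have [-> ->] := rho_sphere t Sy.
by apply: (@retr_stable (dim j) (dim j).+1) => //; exact: (sphere_sk cw).
Qed.

Lemma retr_target m x t : sk m x ->
  (retr m x t).2 = zero \/ sk n (retr m x t).1.
Proof.
elim: m x t => [|m IH] x t xm; first by case: xm.
have [xlt|] := boolP (cdim x < m)%N.
  by rewrite (@retr_stable m) //; [apply: IH|]; apply/sk_cdim.
rewrite -leqNgt => mx; have xE : cdim x = m.
  by apply/eqP; rewrite eqn_leq mx -ltnS andbT; exact/sk_cdim.
have [nm|] := leqP n m; last first.
  by move=> mn; rewrite retr_sk; [right|]; apply/sk_cdim; rewrite xE.
rewrite /= xE eqxx nm /=.
have [->|Sy] := rho_target (tagged (cell x)) t; first by rewrite retr0; left.
by apply: IH; rewrite -xE; exact: (sphere_sk cw).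
Qed.

Lemma retr_cts m :
  continuous (fun z : set_type (sk m) * unitI R => retr m (set_val z.1) z.2).
Proof.
elim: m => [|m IH].
  by move=> [[x xm] t]; exfalso; have /= [] := set_mem xm.
apply: (cells_cts_cylinder cw); first by move=> j; exact: (sk_disk cw).
move=> j /= jm.
have cPhi := disk_cts cw (j := j).
have [jlt|] := boolP (dim j < m)%N.
  have mem (z : set_type (D j) * unitI R) : sk m (Phi (set_val z.1)).
    by apply: (sk_disk cw) => //; exact: set_valP.
  apply: (@eq_cts _ _ (fun z => retr m (Phi (set_val z.1)) z.2)).
    by move=> z; symmetry; apply: (@retr_stable m m.+1) => //; exact: mem.
  pose k (z : set_type (D j) * unitI R) : set_type (sk m) :=
    exist (fun x => x \in sk m) _ (mem_set (mem z)).
  have ck : continuous k.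
    apply: cts_sub; exact: (cts_comp cPhi (cts_fst (@cts_id _))).
  by apply: (cts_comp IH (cts_pair ck (cts_snd (@cts_id _)))).
rewrite -leqNgt => mj; have jE : dim j = m by apply/eqP; rewrite eqn_leq mj -ltnS jm.
have nm_mn : (n <= m)%N || (m < n)%N by rewrite leqNgt orNb.
case/orP: nm_mn => [nm|mn]; last first.
  apply: (@eq_cts _ _ (fun z : set_type (D j) * unitI R => (Phi (set_val z.1), z.2))).
    move=> z; symmetry; apply: (@retr_sk m.+1).
    by apply: (sk_disk cw); [rewrite jE|exact: set_valP].
  apply: cts_pair; last exact: (cts_snd (@cts_id _)).
  exact: (cts_comp cPhi (cts_fst (@cts_id _))).
pose p (z : set_type (D j) * unitI R) := rho_pt (set_val z.1) z.2.
pose s (z : set_type (D j) * unitI R) := rho_time (set_val z.1) z.2.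
pose v (z : set_type (D j) * unitI R) := (set_val z.1, z.2).
have cv : continuous v.
  apply: cts_pair; last exact: (cts_snd (@cts_id _)).
  exact: (cts_val (cts_fst (@cts_id _))).
have cp : continuous p := cts_comp (@rho_pt_cts R (dim j)) cv.
have cs : continuous s := cts_comp (@rho_time_cts R (dim j)) cv.
pose F z := retr m (Phi (p z)) (s z).
apply: (@eq_cts _ _ F).
  move=> z; symmetry; apply: (@retr_cell m) => //; exact: set_valP.
have cPp : continuous (fun z => Phi (p z)).
  have mem z : cdisk R (dim j) (p z) by exact: rho_cdisk.
  pose k z : set_type (D j) := exist (fun y => y \in cdisk R (dim j)) _ (mem_set (mem z)).
  have ck : continuous k by apply: cts_sub.
  exact: (cts_comp cPhi ck).
pose C1 := [set z | uval (s z) <= 0]; pose C2 := [set z | 1 - sqsum (p z) <= 0].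
have C12 : C1 `|` C2 = setT.
  apply/seteqP; split => // z _.
  have [sz|Sz] := rho_target (set_val z.1) z.2; [left|right].
    by rewrite /C1 /= /s sz.
  by rewrite /C2 /= /p [sqsum _]Sz subrr.
have cl1 : closed C1 by apply: closed_le0; exact: (cts_uval cs).
have cl2 : closed C2.
  have c := cts_comp (@sqsum_cts R (dim j)) cp; apply: closed_le0.
  by apply: cts_add; [exact: cts_cst|exact: cts_opp].
apply/continuous_subspace_setT; rewrite -C12; apply: withinU_continuous => //.
  apply: (@subspace_eq_continuous _ C1 _ (fun z => (Phi (p z), zero : unitI R))).
    move=> z zC; have sz : s z = zero.
      by rewrite -[s z]clampK clamp0 //; exact: (set_mem zC).
    by change ((Phi (p z), zero) = retr m (Phi (p z)) (s z)); rewrite sz retr0.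
  by apply: continuous_subspaceT; apply: cts_pair => //; exact: cts_cst.
apply/subspace_sigL_continuousP.
have mem (z : set_type C2) : sk m (Phi (p (set_val z))).
  rewrite -jE; apply: (sphere_sk cw); rewrite /bsphere /=.
  have Dz : cdisk R (dim j) (p (set_val z)) by exact: rho_cdisk.
  apply/eqP; rewrite eq_le; apply/andP; split; first exact: Dz.
  by have := set_valP z; rewrite /C2 /= subr_le0.
pose k (z : set_type C2) : set_type (sk m) :=
  exist (fun x => x \in sk m) _ (mem_set (mem z)).
have cval : continuous (set_val : set_type C2 -> _) by exact: (cts_val (@cts_id _)).
have ck : continuous k by apply: cts_sub; exact: (cts_comp cPp cval).
exact: (cts_comp IH (cts_pair ck (cts_comp cs cval))).
Qed.

Lemma cw_retraction : exists2 r : T * unitI R -> T * unitI R, continuous r &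
  [/\ forall x, r (x, zero) = (x, zero), forall x t, sk n x -> r (x, t) = (x, t) &
      forall z, (r z).2 = zero \/ sk n (r z).1].
Proof.
have own x : sk (cdim x).+1 x by apply/sk_cdim.
exists (fun z => retr (cdim z.1).+1 z.1 z.2); last first.
  split => [x|x t|[x t]]; [exact: retr0|exact: retr_sk|exact: retr_target].
pose g x t := retr (cdim x).+1 x t.
have gE m x t : sk m x -> g x t = retr m x t.
  by move=> xm; symmetry; apply: retr_stable => //; exact/sk_cdim.
have cg : continuous (fun z : set_type (cells setT) * unitI R => g (set_val z.1) z.2).
  apply: (cells_cts_cylinder cw) => [j _ y _|j _]; first by rewrite (cells_all cw).
  have mem (z : set_type (D j) * unitI R) : sk (dim j).+1 (Phi (set_val z.1)).
    by apply: (disk_sk cw); exact: set_valP.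
  apply: (@eq_cts _ _ (fun z => retr (dim j).+1 (Phi (set_val z.1)) z.2)).
    by move=> z; rewrite (gE (dim j).+1).
  move: (dim j).+1 mem => m mem.
  pose k (z : set_type (D j) * unitI R) : set_type (sk m) :=
    exist (fun x => x \in sk m) _ (mem_set (mem z)).
  have ck : continuous k.
    apply: cts_sub; exact: (cts_comp (disk_cts cw (j := j)) (cts_fst (@cts_id _))).
  exact: (cts_comp (@retr_cts m) (cts_pair ck (cts_snd (@cts_id _)))).
have mem (z : T * unitI R) : cells setT z.1 by rewrite (cells_all cw).
pose k (z : T * unitI R) : set_type (cells setT) :=
  exist (fun x => x \in cells setT) _ (mem_set (mem z)).
have ck : continuous k by apply: cts_sub; exact: (cts_fst (@cts_id _)).
exact: (cts_comp cg (cts_pair ck (cts_snd (@cts_id _)))).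
Qed.

End Fixed.
End CWRetraction.

(** * Maps of fibrations over a connected CW complex *)

Section Joined.
Variables (R : realType) (T : topologicalType).

Definition joined (x y : T) : Prop := exists h : unitI R -> T,
  [/\ continuous h, h zero = x & h one = y].

Lemma joined_refl x : joined x x.
Proof. by exists (fun=> x); split => //; exact: cts_cst. Qed.

Lemma joined_sym x y : joined x y -> joined y x.
Proof.
case=> h [ch h0 h1]; exists (fun t => h (clamp (1 - uval t))); split; first by cts.
  by rewrite val_zero subr0 clamp1.
by rewrite val_one subrr clamp0.
Qed.

Lemma joined_trans y x z : joined x y -> joined y z -> joined x z.
Proof.
case=> h [ch h0 h1] [k [ck k0 k1]].
have c : continuous (hcat (fun z : T * unitI R => h z.2) (fun z => k z.2)).
  by apply: cts_hcat; [cts|cts|move=> ? /=; rewrite h1 k0].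
exists (fun t => hcat (fun z : T * unitI R => h z.2) (fun z => k z.2) (x, t)).
by split; [cts|rewrite hcat0|rewrite hcat1].
Qed.

End Joined.

(** The map of fibres over [e] is a homotopy equivalence.  The parameter space
    [A] gives this the form in which constant maps to the base provide it. *)
Definition fibre_fhe (R : realType) (B : topologicalType) (E E' : fwSpace B)
    (f : fwMap E E') (e : B) : Prop :=
  forall A : topologicalType, fw_homotopy_equiv R (pb_map (fun _ : A => e) f).

Section CWDold.
Variables (R : realType) (T : topologicalType) (J : choiceType) (dim : J -> nat).
Variable Phi : forall j, 'rV[R]_(dim j) -> T.
Hypothesis cw : CW_structure Phi.
Notation D j := (cdisk R (dim j)).
Notation O j := (odisk R (dim j)).
Notation sk := (sk Phi).
Notation cells := (cells Phi).
Notation cell := (cell cw).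
Notation cdim := (cdim cw).

Lemma ray_cts (X : topologicalType) j (y : X -> 'rV[R]_(dim j)) (t : X -> unitI R) :
  continuous y -> continuous t -> (forall x, D j (y x)) ->
  continuous (fun x => @Phi j ((1 - uval (t x)) *: y x)).
Proof.
move=> cy ct Dy.
have mem x : cdisk R (dim j) ((1 - uval (t x)) *: y x).
  have ? := unitI_ge0 (t x); have ? := unitI_le1 (t x).
  by apply: cdiskZ => //; apply/andP; split; lra.
pose k x : set_type (D j) := exist (fun y => y \in cdisk R (dim j)) _ (mem_set (mem x)).
have ck : continuous k.
  apply: cts_sub => x; apply: cvgZ; last exact: cy.
  have c : continuous (fun x => 1 - uval (t x)) by cts.
  exact: c.
exact: (cts_comp (disk_cts cw (j := j)) ck).
Qed.

Lemma joined_centre j y : D j y -> joined R (@Phi j y) (@Phi j 0).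
Proof.
move=> Dy; exists (fun t => Phi ((1 - uval t) *: y)); split.
- by apply: ray_cts => //; [exact: cts_cst|exact: cts_id].
- by rewrite val_zero subr0 scale1r.
- by rewrite val_one subrr scale0r.
Qed.

(** The set of points joined to a given one contains with a point of a closed
    cell the whole of it; so this set and its complement are both closed. *)
Lemma cw_joined : connected [set: T] -> forall x y : T, joined R x y.
Proof.
move=> conT x y.
have clopen (P : T -> Prop) : (forall j z, D j z -> P (@Phi j z) <-> P (@Phi j 0)) ->
    closed [set z | P z].
  move=> PD; apply: (closed_cells cw (Q := setT)) => [z _|j _].
    by rewrite (cells_all cw).
  have cD : closed (@Phi j @` D j).
    by have := disk_closed cw (j := j) closedT; rewrite setIT.
  have [P0|nP0] := pselect (P (Phi (0 : 'rV_(dim j)))).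
    rewrite (_ : _ `&` _ = @Phi j @` D j) //.
    apply/seteqP; split => [z []//|_ [z Dz <-]]; split; last by exists z.
    exact/PD.
  rewrite (_ : _ `&` _ = set0) //; first exact: closed0.
  rewrite -subset0 => x0 [/= Pz [z Dz zx]].
  by move: Pz; rewrite -zx => /(PD j z Dz) /nP0.
have jD j z : D j z -> joined R x (@Phi j z) <-> joined R x (@Phi j 0).
  move=> /joined_centre jz; split=> h; apply: joined_trans h _ => //.
  exact: joined_sym.
have : [set z | joined R x z] = setT.
  apply: conT.
  - by exists x; exact: joined_refl.
  - exists (~` [set z | ~ joined R x z]); last by rewrite setTI setCK.
    apply: closed_openC; apply: clopen => j z Dz.
    by split=> h1 h2; apply: h1; apply/(jD j z).
  - by exists [set z | joined R x z]; [apply: clopen|rewrite setTI].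
by move=> /seteqP[_ /(_ y I)].
Qed.

(** Each of these cells is open in their union. *)
Lemma top_cells_cts n (Y : topologicalType) (G : T -> unitI R -> Y) :
  (forall j, dim j = n -> continuous
     (fun z : set_type (@Phi j @` O j) * unitI R => G (set_val z.1) z.2)) ->
  continuous (fun z : set_type [set x | cdim x = n] * unitI R => G (set_val z.1) z.2).
Proof.
move=> cG z0; pose j := tag (cell (set_val z0.1)).
have jn : dim j = n by exact: (set_valP z0.1).
have [V oV VE] := top_cell_open cw jn.
pose P := set_type [set x | cdim x = n].
have inj (z : P * unitI R) : V (set_val z.1) -> (@Phi j @` O j) (set_val z.1).
  move=> Vz; rewrite -VE; split => //; apply/(sk_cdim cw).
  by rewrite (set_valP z.1).
have cv : continuous (fun z : P * unitI R => set_val z.1).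
  exact: (cts_val (cts_fst (@cts_id _))).
apply: (@cts_at_open _ _ [set z : P * unitI R | V (set_val z.1)]).
- by apply: open_comp => // z _; exact: cv.
- have mem (z : [set z : P * unitI R | V (set_val z.1)]) :
    (@Phi j @` O j) (set_val (set_val z).1) by apply: inj; exact: (set_valP z).
  pose k z : set_type (@Phi j @` O j) :=
    exist (fun x => x \in @Phi j @` O j) _ (mem_set (mem z)).
  have cval : continuous (set_val : [set z : P * unitI R | V (set_val z.1)] -> _).
    exact: (cts_val (@cts_id _)).
  have ck : continuous k by apply: cts_sub; exact: (cts_comp cv cval).
  exact: (cts_comp (cG j jn) (cts_pair ck (cts_snd cval))).
- have : (@Phi j @` O j) (set_val z0.1).
    by exists (tagged (cell (set_val z0.1))); [exact: cell_open|exact: cellK].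
  by rewrite -VE => -[].
Qed.

Variables (E E' : fwSpace T) (f : fwMap E E') (e : T).
Hypothesis hE : hurewicz_fibration R E.
Hypothesis hE' : hurewicz_fibration R E'.
Hypothesis fe : fibre_fhe R f e.
Hypothesis conT : connected [set: T].

(** Contract each cell to its centre, and move the centre along a path to [e]. *)
Lemma open_cells_fhe n :
  fw_homotopy_equiv R (pb_map (set_val : set_type [set x | cdim x = n] -> T) f).
Proof.
pose P := set_type [set x | cdim x = n].
pose centre (x : P) : T := @Phi (tag (cell (set_val x))) 0.
have [g Hg] := choice (fun j => cw_joined conT (@Phi j 0) e).
apply: (@pb_fhe_homotopy R T P _ centre (fun z : P * unitI R =>
  Phi ((1 - uval z.2) *: tagged (cell (set_val z.1)))) E E') => //.
- apply: (top_cells_cts (G := fun x t => Phi ((1 - uval t) *: tagged (cell x)))).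
  move=> j jn.
  have [c cK] : exists c : T -> 'rV[R]_(dim j), forall y, O j y -> c (@Phi j y) = y.
    have /choice[c Hc] (x : T) : exists y : 'rV[R]_(dim j),
        (@Phi j @` O j) x -> O j y /\ Phi y = x.
      have [[y Oy yx]|nx] := pselect ((@Phi j @` O j) x); first by exists y.
      by exists 0.
    exists c => y Oy; have [|Ocy cy] := Hc (Phi y); first by exists y.
    by apply: (cw_inj cw _ _ cy); exact: mem_set.
  have jP (z : set_type (@Phi j @` O j) * unitI R) := set_valP z.1.
  apply: (@eq_cts _ _ (fun z : set_type (@Phi j @` O j) * unitI R =>
      Phi ((1 - uval z.2) *: c (set_val z.1)))).
    move=> z; have [y Oy yx] := jP z.
    have -> : set_val z.1 = Phi y := esym yx.
    by rewrite cK // cell_Phi.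
  apply: ray_cts.
  + exact: (cts_comp (cell_coord_cts cw cK) (cts_fst (@cts_id _))).
  + exact: (cts_snd (@cts_id _)).
  + move=> z; have [y Oy yx] := jP z.
    have -> : set_val z.1 = Phi y := esym yx.
    by rewrite cK //; apply/cdiskP; left.
- by move=> x; rewrite val_zero subr0 scale1r cellK.
- by move=> x; rewrite val_one subrr scale0r.
apply: (@pb_fhe_homotopy R T P centre (fun=> e) (fun z : P * unitI R =>
  g (tag (cell (set_val z.1))) z.2) E E') => //.
- apply: (top_cells_cts (G := fun x t => g (tag (cell x)) t)) => j jn.
  apply: (@eq_cts _ _ (fun z : set_type (@Phi j @` O j) * unitI R => g j z.2)).
    move=> z; have [y Oy yx] := set_valP z.1.
    have -> : set_val z.1 = Phi y := esym yx.
    by rewrite cell_Phi.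
  have [cg _ _] := Hg j.
  exact: (cts_comp cg (cts_snd (@cts_id _))).
- by move=> x; have [_ + _] := Hg (tag (cell (set_val x))).
- by move=> x; have [_ _ +] := Hg (tag (cell (set_val x))).
Qed.

(** The first component of the retraction of the cylinder is a homotopy of the
    identity.  If the image of the top of the cylinder over a point has positive
    height, then it lies over the skeleton; so this height serves as [u n]. *)
Lemma skeleton_neighbourhoods :
  exists (u : nat -> T -> R) (r : nat -> T * unitI R -> T),
    forall n, [/\ continuous (u n), forall x, 0 <= u n x <= 1,
      forall x, sk n x -> u n x = 1, continuous (r n) &
      (forall x, r n (x, zero) = x) /\ (forall x, 0 < u n x -> sk n (r n (x, one)))].
Proof.
have /choice[r Hr] n : exists r : T * unitI R -> T * unitI R, continuous r /\
  [/\ forall x, r (x, zero) = (x, zero), forall x t, sk n x -> r (x, t) = (x, t) &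
      forall z, (r z).2 = zero \/ sk n (r z).1].
  by have [r cr Hr] := cw_retraction cw n; exists r.
exists (fun n x => uval (r n (x, one)).2), (fun n z => (r n z).1) => n.
have [cr [r0 r_sk rP]] := Hr n; split.
- by cts.
- by move=> x; rewrite unitI_ge0 unitI_le1.
- by move=> x xn; rewrite r_sk.
- by cts.
split=> [x|x]; first by rewrite r0.
by have [->|//] := rP (x, one); rewrite ltxx.
Qed.

Lemma near_skeleton_fhe n (u : T -> R) (r : T * unitI R -> T) (P : set T) :
  continuous r -> (forall x, r (x, zero) = x) ->
  (forall x, P x -> sk n (r (x, one))) ->
  fw_homotopy_equiv R (pb_map (set_val : set_type (sk n) -> T) f) ->
  fw_homotopy_equiv R (pb_map (set_val : set_type P -> T) f).
Proof.
move=> cr r0 rn fn.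
have mem (x : set_type P) : sk n (r (set_val x, one)) by apply: rn; exact: set_valP.
pose k (x : set_type P) : set_type (sk n) :=
  exist (fun x => x \in sk n) _ (mem_set (mem x)).
have cval : continuous (fun x : set_type P => set_val x) by exact: (cts_val (@cts_id _)).
have ck : continuous k.
  by apply: cts_sub; exact: (cts_comp cr (cts_pair cval (@cts_cst _ _ one))).
apply: (@pb_fhe_homotopy R T _ _ (fun x => set_val (k x))
  (fun z : set_type P * unitI R => r (set_val z.1, z.2)) E E') => //.
  by cts.
exact: pb_fhe_comp.
Qed.

(** Induction over skeleta: the next skeleton is the union of a neighbourhood
    of the last one and of the open cells. *)
Lemma skeleton_fhe n :
  fw_homotopy_equiv R (pb_map (set_val : set_type (sk n) -> T) f).
Proof.
have [u [r Hur]] := skeleton_neighbourhoods.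
elim: n => [|n IH].
  have empty (z : pb (set_val : set_type (sk 0) -> T) E') : False.
    by have [] := set_valP (fw_proj z).
  have cg : continuous (fun z : pb (set_val : set_type (sk 0) -> T) E' =>
      False_rect (pb (set_val : set_type (sk 0) -> T) E) (empty z)).
    by move=> z; case: (empty z).
  have gp (z : pb (set_val : set_type (sk 0) -> T) E') :
      fw_proj (False_rect (pb (set_val : set_type (sk 0) -> T) E) (empty z)) = fw_proj z.
    by case: (empty z).
  pose g := @FwMap _ (pb (set_val : set_type (sk 0) -> T) E')
    (pb (set_val : set_type (sk 0) -> T) E) _ cg gp.
  apply: (@fhe_iso R _ _ _ _ g) => z; last by case: (empty z).
  by have [] := set_valP (fw_proj z).
have [cu u01 u_sk cr [r0 r1]] := Hur n.
have cval : continuous (fun x : set_type (sk n.+1) => set_val x).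
  exact: (cts_val (@cts_id _)).
pose lam (b : bool) (x : set_type (sk n.+1)) : R :=
  if b then u n (set_val x) else 1 - u n (set_val x).
apply: (@dold_local R _ bool lam).
- by case; rewrite /lam; cts.
- by move=> b x; have /andP[? ?] := u01 (set_val x); case: b; rewrite /lam //; lra.
- move=> x; exists setT; first exact: filterT.
  exact: (sub_finite_set _ (finite_finpred (@predT bool))).
- move=> x; case: (ltP 0 (u n (set_val x))) => h; first by exists true.
  by exists false; rewrite /lam; lra.
pose Q (b : bool) := if b then [set x | 0 < u n x] else [set x | cdim x = n].
have fQ b : fw_homotopy_equiv R (pb_map (set_val : set_type (Q b) -> T) f).
  case: b; last exact: open_cells_fhe.
  exact: (@near_skeleton_fhe n (u n) (r n)).
have mem b (x : set_type [set x | 0 < lam b x]) : Q b (set_val (set_val x)).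
  case: b x => x; have := set_valP x; rewrite /lam /Q //=.
  have xn := set_valP (set_val x) => ux.
  apply/eqP; rewrite eqn_leq; apply/andP; split.
    by rewrite -ltnS; apply/(sk_cdim cw).
  rewrite leqNgt; apply/negP => /(sk_cdim cw) /u_sk xE.
  by move: ux; rewrite xE subrr ltxx.
move=> b; have cO : continuous (fun x : set_type [set x | 0 < lam b x] => set_val x).
  exact: (cts_val (@cts_id _)).
apply: (proj1 (@pb_pb R T (set_type (sk n.+1)) _ set_val _ cO E E' f)).
pose k (x : set_type [set x | 0 < lam b x]) : set_type (Q b) :=
  exist (fun x => x \in Q b) _ (mem_set (mem b x)).
have ck : continuous k by apply: cts_sub; exact: (cts_comp cval cO).
exact: (@pb_fhe_comp R T (set_type (Q b)) _ set_val k ck E E' f (fQ b)).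
Qed.

(** Dold's theorem for the cover by the neighbourhoods of the skeleta. *)
Theorem cw_fhe : fw_homotopy_equiv R f.
Proof.
have [u [r Hur]] := skeleton_neighbourhoods.
have u_ge0 n x : 0 <= u n x by have [_ /(_ x)/andP[]] := Hur n.
have u_le1 n x : u n x <= 1 by have [_ /(_ x)/andP[]] := Hur n.
have cu n : continuous (u n) by have [] := Hur n.
(* Subtracting multiples of the earlier functions makes the family locally
   finite without losing the first function that does not vanish. *)
pose v n x := Num.max 0 (u n x - n%:R * \sum_(i <- iota 0 n) u i x).
have csum n : continuous (fun x => \sum_(i <- iota 0 n) u i x).
  exact: (@sum_lam_cts R T nat u cu).
have cv n : continuous (v n) by rewrite /v; have ? := csum n; have ? := cu n; cts.
have vu n x : 0 < v n x -> 0 < u n x.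
  rewrite /v lt_max ltxx /= subr_gt0; apply: le_lt_trans.
  by rewrite mulr_ge0 ?ler0n //; apply: sumr_ge0.
have u_eq1 x : u (cdim x).+1 x = 1.
  by have [_ _ + _ _] := Hur (cdim x).+1; apply; exact/(sk_cdim cw).
apply: (@dold_local R T nat v).
- exact: cv.
- by move=> n x; rewrite /v le_max lexx.
- move=> x; pose m := (cdim x).+1.
  (* Where [u m] is larger than 1/2, subtracting [n] times a sum that contains
     [u m] leaves nothing positive once [n] is at least 2. *)
  exists [set y | 0 < 2 * u m y - 1].
    have c : continuous (fun y => 2 * u m y - 1) by have ? := cu m; cts.
    apply: open_nbhs_nbhs; split; first exact: (open_gt0 c).
    by rewrite /= /m u_eq1; lra.
  apply: (@sub_finite_set _ _ [set n | (n < (m + 2).+1)%N]); last exact: finite_II.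
  move=> n [y /= my]; apply: contraNT; rewrite -leqNgt => mn.
  apply/eqP/max_idPl; rewrite subr_le0; apply: le_trans (u_le1 n y) _.
  have s_ge : u m y <= \sum_(i <- iota 0 n) u i y.
    rewrite (bigD1_seq m) ?iota_uniq //=.
      by rewrite lerDl; apply: sumr_ge0.
    by rewrite mem_iota /= add0n; apply: leq_trans mn; rewrite addn2 ltnS; apply: leqW.
  have n2 : 2 <= n%:R :> R by rewrite ler_nat; apply: leq_trans mn; rewrite addn2.
  have ? := u_ge0 m y; nra.
- move=> x.
  have ex : exists n, 0 < u n x by exists (cdim x).+1; rewrite u_eq1.
  exists (ex_minn ex); case: ex_minnP => n un nmin.
  rewrite /v lt_max; apply/orP; right; rewrite big1_seq ?mulr0 ?subr0 // => i /=.
  rewrite mem_iota /= add0n => i_n; apply/eqP; rewrite eq_le u_ge0 andbT leNgt.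
  by apply/negP => /nmin; rewrite leqNgt i_n.
move=> n; have [_ _ _ cr [r0 r1]] := Hur n.
apply: (@near_skeleton_fhe n (u n) (r n)) => // [x /vu|]; first exact: r1.
exact: skeleton_fhe.
Qed.

End CWDold.

(** * Shearing on a fibre *)

Section TrivialFibration.
Variables (R : realType) (T F : topologicalType).

Definition triv : fwSpace T := FwSpace (cts_fst (@cts_id (T * F)%type)).

Lemma triv_hurewicz : hurewicz_fibration R triv.
Proof.
move=> Z f H cf cH H0; exists (fun z => (H z, (f z.1).2)); split => //.
- by cts.
- by move=> z; rewrite H0 /= -surjective_pairing.
Qed.

End TrivialFibration.

Section FibreShearing.
Variables (R : realType) (B : topologicalType) (X : pfwSpace B) (b : B).
Variable mu : pfwMap (fwprod X X) X.
Notation T := (fibre X b).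
Notation P := (fwprod X X).

Lemma fibre_proj (x : T) : fw_proj (set_val x) = b.
Proof. exact: (set_valP x). Qed.

Lemma fibre_pair_mem (z : T * T) : @fwprod_set B X X (set_val z.1, set_val z.2).
Proof. by rewrite /fwprod_set /= !fibre_proj. Qed.

Definition fibre_pair (z : T * T) : P :=
  exist (fun z => z \in @fwprod_set B X X) _ (mem_set (fibre_pair_mem z)).

Lemma fibre_pair_cts (Z : topologicalType) (h : Z -> T * T) :
  continuous h -> continuous (fun z => fibre_pair (h z)).
Proof.
move=> ch; apply: cts_sub; apply: cts_pair; apply: cts_val.
  exact: (cts_fst ch).
exact: (cts_snd ch).
Qed.

Definition fibre_mk (x : X) (H : fw_proj x = b) : T :=
  exist (fun x => x \in @fw_proj B X @^-1` [set b]) x (mem_set H).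

Definition fibre_pt : T := fibre_mk (@pfw_secK B X b).

Lemma fibre_mul_mem (z : T * T) : fw_proj (mu (fibre_pair z)) = b.
Proof. by rewrite fw_fun_proj; exact: fibre_proj. Qed.

Definition fibre_sh_fun (z : triv T T) : triv T T := (z.1, fibre_mk (fibre_mul_mem z)).

Lemma fibre_sh_cts : continuous fibre_sh_fun.
Proof.
apply: cts_pair; first exact: (cts_fst (@cts_id (T * T)%type)).
apply: cts_sub; apply: (cts_comp (fw_fun_cts mu)).
exact: (fibre_pair_cts (@cts_id (T * T)%type)).
Qed.

Definition fibre_sh : fwMap (triv T T) (triv T T) :=
  @FwMap T (triv T T) (triv T T) _ fibre_sh_cts (fun=> erefl).

(** Over the base point the shearing map is multiplication by the unit. *)
Lemma fibre_sh_pt : fw_Hspace R mu -> fibre_fhe R fibre_sh fibre_pt.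
Proof.
case=> _ [H [H0 H1 _]] A; set c := fun _ : A => fibre_pt.
have h_fst (z : pb c (triv T T)) : (set_val z).2.1 = fibre_pt by exact: (pb_eq z).
have mem (z : pb c (triv T T) * unitI R) :
    fw_proj (H (set_val (set_val z.1).2.2, z.2)) = b.
  by rewrite fw_fun_proj; exact: fibre_proj.
pose h (z : pb c (triv T T) * unitI R) : triv T T :=
  (fibre_pt, fibre_mk (mem z)).
have ch : continuous h.
  apply: cts_pair; first exact: cts_cst.
  apply: cts_sub; apply: (cts_comp (fw_fun_cts H)); apply: cts_pair.
    by cts.
  exact: (cts_snd (@cts_id _)).
have hc z : fw_proj (h z) = c (fw_proj z.1) by [].
apply: (@fhe_homotopic R A _ _ (fw_id (pb c (triv T T)))); last first.
  exact: (@fhe_iso R A _ _ (fw_id _) (fw_id _)).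
apply: fwh_sym.
apply: (@fwhI R A _ _ (pb_map c fibre_sh) (fw_id _) (fun z => pb_mk (hc z))) => //.
- by apply: pb_cts => //; cts.
- move=> z; apply: pb_inj => //=.
  rewrite /h /fibre_sh_fun h_fst; congr pair; apply: val_inj => /=.
  rewrite H0 /=; congr (mu _); apply: val_inj => /=.
  by rewrite h_fst /= fibre_proj.
- move=> z; apply: pb_inj => //=.
  rewrite [RHS]surjective_pairing h_fst /h; congr pair; apply: val_inj => /=.
  by rewrite H1.
Qed.

Section Spread.
Variable A : topologicalType.
Notation PA := (pb (fun _ : A => b) P).

Lemma spread_mem1 (z : PA) : fw_proj (set_val (set_val z).2).1 = b.
Proof. exact: (pb_eq z). Qed.

Lemma spread_mem2 (z : PA) : fw_proj (set_val (set_val z).2).2 = b.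
Proof. exact: (etrans (esym (set_valP (set_val z).2)) (spread_mem1 z)). Qed.

Definition split_pair (z : PA) : triv T T :=
  (fibre_mk (spread_mem1 z), fibre_mk (spread_mem2 z)).

Lemma split_pair_cts : continuous split_pair.
Proof.
apply: cts_pair; apply: cts_sub.
  by change (continuous (fun z : PA => (set_val (set_val z).2).1)); cts.
by change (continuous (fun z : PA => (set_val (set_val z).2).2)); cts.
Qed.

Lemma spread_mem (z : T * T) : fw_proj (fibre_pair z) = b.
Proof. exact: fibre_proj. Qed.

Definition join_pair (a : A) (z : T * T) : PA :=
  @pb_mk B A (fun _ => b) P a (fibre_pair z) (spread_mem z).

Lemma join_pair_cts (Z : topologicalType) (a : Z -> A) (h : Z -> T * T) :
  continuous a -> continuous h -> continuous (fun z => join_pair (a z) (h z)).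
Proof. by move=> ca ch; apply: pb_cts => //; exact: fibre_pair_cts. Qed.

Lemma split_pairK z : join_pair (fw_proj z) (split_pair z) = z.
Proof. by apply: pb_inj => //; apply: val_inj => /=; rewrite -surjective_pairing. Qed.

Lemma join_pairK a z : split_pair (join_pair a z) = z.
Proof. by case: z => x y; congr pair; apply: val_inj. Qed.

Lemma spread_cts (k : fwMap (triv T T) (triv T T)) :
  continuous (fun z : PA => join_pair (fw_proj z) (k (split_pair z))).
Proof. by have ? := split_pair_cts; apply: join_pair_cts; cts. Qed.

(** The fibre of the product at [b] is the product of the fibre with itself;
    this is [k] under this identification, with parameters in [A]. *)
Definition spread (k : fwMap (triv T T) (triv T T)) : fwMap PA PA :=
  @FwMap A PA PA _ (@spread_cts k) (fun=> erefl).

Lemma spread_homotopic (k l : fwMap (triv T T) (triv T T)) :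
  fw_homotopic R k l -> fw_homotopic R (spread k) (spread l).
Proof.
case/fwhE => h [ch _ h0 h1]; have cs := split_pair_cts.
apply: (@fwhI R A PA PA _ _
  (fun z => join_pair (fw_proj z.1) (h (split_pair z.1, z.2)))) => //.
- by apply: join_pair_cts; cts.
- by move=> z; rewrite h0.
- by move=> z; rewrite h1.
Qed.

Lemma spread_fhe (k : fwMap (triv T T) (triv T T)) :
  fw_homotopy_equiv R k -> fw_homotopy_equiv R (spread k).
Proof.
case=> l [/spread_homotopic lk /spread_homotopic kl]; exists (spread l); split.
  apply: (fwh_trans _ (fwh_trans lk _)); apply: fwh_refl => z.
    by rewrite /= join_pairK.
  by rewrite /= split_pairK.
apply: (fwh_trans _ (fwh_trans kl _)); apply: fwh_refl => z.
  by rewrite /= join_pairK.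
by rewrite /= split_pairK.
Qed.

End Spread.

(** Shearing on the fibre is a map of trivial fibrations over the first factor,
    which is a connected CW complex, and an equivalence over its base point. *)
Lemma shearing_fibre_fhe : fw_Hspace R mu ->
  connected [set: T] -> CW_complex R T -> fibre_fhe R (fw_shearing mu) b.
Proof.
move=> muH conT [J [dim [Phi cw]]] A.
have shT : fw_homotopy_equiv R fibre_sh.
  apply: (@cw_fhe R T {classic J} dim Phi cw _ _ fibre_sh fibre_pt) => //.
  - exact: triv_hurewicz.
  - exact: triv_hurewicz.
  - exact: fibre_sh_pt.
apply: fhe_homotopic (spread_fhe A shT); apply: fwh_refl => z.
apply: pb_inj => //; apply: val_inj => /=; congr (_, mu _).
by apply: val_inj; rewrite /= -surjective_pairing.
Qed.

End FibreShearing.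

(** * Maps of weak fibrations over a numerably categorical base *)

Section DoldCategorical.
Variables (R : realType) (B : topologicalType).
Hypothesis B_connected : path_connected R B.
Hypothesis B_categorical : numerably_categorical R B.

(** Each set of the cover is contracted to a point, and this point is moved along
    a path to [b]. *)
Lemma dold_hurewicz (E E' : fwSpace B) (f : fwMap E E') (b : B) :
  hurewicz_fibration R E -> hurewicz_fibration R E' ->
  fibre_fhe R f b -> fw_homotopy_equiv R f.
Proof.
move=> hE hE' fb; have [J [V [[_ [lam [cl l0 lfin l1] lV]] Vnull]]] := B_categorical.
apply: (@dold_local R B J lam) => //.
  move=> x; apply/not_existsP => nx; have /eqP := l1 x; apply/negP.
  rewrite fsbig1 ?(eq_sym 0) ?oner_eq0 // => j _.
  apply/eqP; rewrite eq_le l0 andbT leNgt; exact/negP/nx.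
move=> j; have [c [H [cH H0 H1]]] := Vnull j.
set O := [set x | 0 < lam j x].
have mem (x : set_type O) : V j (set_val x).
  apply: lV; apply: subset_closure; rewrite /= gt_eqF //; exact: (set_valP x).
pose k (x : set_type O) : set_type (V j) := exist (fun x => x \in V j) _ (mem_set (mem x)).
have ck : continuous k by apply: cts_sub; exact: (cts_val (@cts_id _)).
have [g] := @B_connected c b.
have cg : continuous (g : unitI R -> B) by exact: cts_fun.
apply: (@pb_fhe_homotopy R B (set_type O) _ (fun=> c) (fun z => H (k z.1, z.2))) => //.
  by cts.
apply: (@pb_fhe_homotopy R B (set_type O) _ (fun=> b) (fun z => g z.2)) => //.
- exact: (cts_comp cg (cts_snd (@cts_id _))).
- by move=> x; rewrite path_zero.
- by move=> x; rewrite path_one.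
Qed.

(** Weak fibrations are replaced with equivalent fibrations. *)
Theorem dold_categorical (X X' : fwSpace B) (f : fwMap X X') (b : B) :
  weakly_fibrant R X -> weakly_fibrant R X' ->
  fibre_fhe R f b -> fw_homotopy_equiv R f.
Proof.
move=> [E hE [h [h' [h'h hh']]]] [E' hE' [k kfhe]] fb.
have h'_fhe : fw_homotopy_equiv R h' by exists h.
suff : fw_homotopy_equiv R (fw_comp (fw_comp k f) h').
  by move=> /(fhe_cancel_r h'_fhe) /(fhe_cancel_l kfhe).
apply: (dold_hurewicz (b := b)) => // A.
have kf := fhe_comp (pb_fhe (fun _ : A => b) kfhe) (fb A).
apply: fhe_homotopic (fhe_comp kf (pb_fhe (fun _ : A => b) h'_fhe)).
by apply: fwh_refl => z; exact: pb_inj.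
Qed.

End DoldCategorical.

Section WeaklyFibrantProduct.
Variables (R : realType) (B : topologicalType).
Implicit Types X Y : pfwSpace B.

Definition prod_fst X (z : fwprod X X) : X := (set_val z).1.
Definition prod_snd X (z : fwprod X X) : X := (set_val z).2.

Lemma prod_eq X (z : fwprod X X) : fw_proj (prod_fst z) = fw_proj (prod_snd z).
Proof. exact: (set_valP z). Qed.

Definition prod_mk X (x y : X) (H : fw_proj x = fw_proj y) : fwprod X X :=
  exist (fun z => z \in @fwprod_set B X X) (x, y)
    (mem_set (H : @fwprod_set B X X (x, y))).

Lemma prod_mk_cts X (Z : topologicalType) (x y : Z -> X)
    (H : forall z, fw_proj (x z) = fw_proj (y z)) :
  continuous x -> continuous y -> continuous (fun z => prod_mk (H z)).
Proof. by move=> cx cy; apply: cts_sub; exact: cts_pair. Qed.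

Lemma prod_fst_cts X : continuous (@prod_fst X).
Proof. exact: fwprod_fst_cts. Qed.

Lemma prod_snd_cts X : continuous (@prod_snd X).
Proof. exact: fwprod_snd_cts. Qed.

Lemma prod_inj X (z z' : fwprod X X) :
  prod_fst z = prod_fst z' -> prod_snd z = prod_snd z' -> z = z'.
Proof.
rewrite /prod_fst /prod_snd; case: z z' => [[x y] H] [[x' y'] H'] /= e e'.
by apply: val_inj => /=; rewrite e e'.
Qed.

Lemma prod_map_mem X Y (f : fwMap X Y) (z : fwprod X X) :
  fw_proj (f (prod_fst z)) = fw_proj (f (prod_snd z)).
Proof. by rewrite !fw_fun_proj prod_eq. Qed.

Lemma prod_map_cts X Y (f : fwMap X Y) :
  continuous (fun z => prod_mk (prod_map_mem f z)).
Proof.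
by have ? := @prod_fst_cts X; have ? := @prod_snd_cts X; apply: prod_mk_cts; cts.
Qed.

Lemma prod_map_proj X Y (f : fwMap X Y) (z : fwprod X X) :
  fw_proj (prod_mk (prod_map_mem f z)) = fw_proj z.
Proof. exact: fw_fun_proj. Qed.

Definition prod_map X Y (f : fwMap X Y) : fwMap (fwprod X X) (fwprod Y Y) :=
  FwMap (@prod_map_cts X Y f) (@prod_map_proj X Y f).

Lemma prod_map_homotopic X Y (f g : fwMap X Y) :
  fw_homotopic R f g -> fw_homotopic R (prod_map f) (prod_map g).
Proof.
case/fwhE => h [ch hp h0 h1].
have mem (z : fwprod X X * unitI R) :
    fw_proj (h (prod_fst z.1, z.2)) = fw_proj (h (prod_snd z.1, z.2)).
  by rewrite !hp prod_eq.
have c1 := @prod_fst_cts X; have c2 := @prod_snd_cts X.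
apply: (@fwhI R B _ _ (prod_map f) (prod_map g) (fun z => prod_mk (mem z))).
- by apply: prod_mk_cts; cts.
- by move=> z t; exact: hp.
- by move=> z; apply: prod_inj; exact: h0.
- by move=> z; apply: prod_inj; exact: h1.
Qed.

Lemma prod_map_fhe X Y (f : fwMap X Y) :
  fw_homotopy_equiv R f -> fw_homotopy_equiv R (prod_map f).
Proof.
case=> g [/prod_map_homotopic gf /prod_map_homotopic fg]; exists (prod_map g); split.
  apply: (fwh_trans _ (fwh_trans gf _)); apply: fwh_refl => z; exact: prod_inj.
apply: (fwh_trans _ (fwh_trans fg _)); apply: fwh_refl => z; exact: prod_inj.
Qed.

Lemma fwprod_hurewicz X :
  hurewicz_fibration R X -> hurewicz_fibration R (fwprod X X).
Proof.
move=> hX Z f H cf cH H0; have c1 := @prod_fst_cts X; have c2 := @prod_snd_cts X.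
have [|//||K [cK K0 pK]] := hX Z (fun z => prod_fst (f z)) H.
- by cts.
- by move=> z; rewrite H0.
have [|//||L [cL L0 pL]] := hX Z (fun z => prod_snd (f z)) H.
- by cts.
- by move=> z; rewrite H0 -prod_eq.
have mem z : fw_proj (K z) = fw_proj (L z) by rewrite pK pL.
exists (fun z => prod_mk (mem z)); split.
- exact: prod_mk_cts.
- by move=> z; apply: prod_inj; [exact: K0|exact: L0].
- by move=> z; exact: pK.
Qed.

(** The equivalent fibration is given the image of the section, in order that
    its fibrewise square be formed as a pointed space. *)
Lemma weakly_fibrant_fwprod X : weakly_fibrant R X -> weakly_fibrant R (fwprod X X).
Proof.
case=> E hE [h hfhe].
have s_cts : continuous (fun b => h (pfw_sec X b)) by cts.
have sK b : fw_proj (h (pfw_sec X b)) = b by rewrite fw_fun_proj pfw_secK.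
pose Ep : pfwSpace B := PfwSpace s_cts sK.
exists (fwprod Ep Ep); first exact: fwprod_hurewicz.
by exists (@prod_map X Ep h); exact: prod_map_fhe.
Qed.

End WeaklyFibrantProduct.

(** * Pointed homotopy equivalences of well-pointed spaces *)

Section PointedHomotopy.
Variables (R : realType) (B : topologicalType).
Implicit Types X Y Z : pfwSpace B.
Notation "f ~* g" := (@pfw_homotopic R B _ _ f g) (at level 70).

Lemma pfwhI X Y (f g : pfwMap X Y) (h : X * unitI R -> Y) : continuous h ->
  (forall x t, fw_proj (h (x, t)) = fw_proj x) ->
  (forall x, h (x, zero) = f x) -> (forall x, h (x, one) = g x) ->
  (forall b t, h (pfw_sec X b, t) = pfw_sec Y b) -> f ~* g.
Proof.
move=> ch hp h0 h1 hs.
by exists (@FwMap B (fw_cyl R X) Y h ch (fun xt => let: (x, t) := xt in hp x t)).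
Qed.

Lemma pfwhE X Y (f g : pfwMap X Y) : f ~* g -> exists h : X * unitI R -> Y,
  [/\ continuous h, forall x t, fw_proj (h (x, t)) = fw_proj x,
      forall x, h (x, zero) = f x, forall x, h (x, one) = g x &
      forall b t, h (pfw_sec X b, t) = pfw_sec Y b].
Proof.
case=> H [H0 H1 Hs]; exists H; split => //; first exact: (fw_fun_cts H).
by move=> x t; exact: (fw_fun_proj H (x, t)).
Qed.

Lemma pfwh_refl X Y (f g : pfwMap X Y) : f =1 g -> f ~* g.
Proof.
move=> fg; apply: (@pfwhI X Y f g (fun z => f z.1)) => // [|x t|b t].
- by cts.
- by rewrite fw_fun_proj.
- by rewrite pfw_fun_sec.
Qed.

Lemma pfwh_sym X Y (f g : pfwMap X Y) : f ~* g -> g ~* f.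
Proof.
case/pfwhE => h [ch hp h0 h1 hs]; apply: (@pfwhI X Y g f (hrev h)).
- exact: cts_hrev.
- by move=> x t; rewrite hp.
- by move=> x; rewrite hrev0.
- by move=> x; rewrite hrev1.
- by move=> b t; rewrite /hrev hs.
Qed.

Lemma pfwh_trans X Y (g f k : pfwMap X Y) : f ~* g -> g ~* k -> f ~* k.
Proof.
case/pfwhE => h [ch hp h0 h1 hs] /pfwhE[l [cl lp l0 l1 ls]].
apply: (@pfwhI X Y f k (hcat h l)).
- by apply: cts_hcat => // x; rewrite h1 l0.
- by move=> x; apply: (hcatP (P := fun y => fw_proj y = fw_proj x)).
- by move=> x; rewrite hcat0.
- by move=> x; rewrite hcat1.
- by move=> b; apply: (hcatP (P := fun y => y = pfw_sec Y b)).
Qed.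

Lemma pfwh_compl X Y Z (g : pfwMap Y Z) (f f' : pfwMap X Y) :
  f ~* f' -> pfw_comp g f ~* pfw_comp g f'.
Proof.
case/pfwhE => h [ch hp h0 h1 hs].
apply: (@pfwhI X Z _ _ (fun z => g (h z))) => [|x t|x|x|b t].
- by cts.
- by rewrite fw_fun_proj hp.
- by rewrite h0.
- by rewrite h1.
- by rewrite hs pfw_fun_sec.
Qed.

Lemma pfwh_compr X Y Z (g g' : pfwMap Y Z) (f : pfwMap X Y) :
  g ~* g' -> pfw_comp g f ~* pfw_comp g' f.
Proof.
case/pfwhE => h [ch hp h0 h1 hs].
apply: (@pfwhI X Z _ _ (fun z => h (f z.1, z.2))) => [|x t|x|x|b t].
- by cts.
- by rewrite hp fw_fun_proj.
- by rewrite h0.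
- by rewrite h1.
- by rewrite pfw_fun_sec hs.
Qed.

Lemma pfwh_fwh X Y (f g : pfwMap X Y) : f ~* g -> fw_homotopic R f g.
Proof. by case=> H [H0 H1 _]; exists H. Qed.

End PointedHomotopy.

Section WellPointed.
Variables (R : realType) (B : topologicalType).
Implicit Types X Y : pfwSpace B.

Lemma sec_range X (x : X) : range (fw_sec X) x -> x = pfw_sec X (fw_proj x).
Proof. by case=> b _ <-; rewrite /= pfw_secK. Qed.

(** Extend the inclusions of the bottom of the cylinder and of the cylinder over
    the section into their union. *)
Lemma well_pointed_retraction X : fw_well_pointed R X ->
  exists2 r : X * unitI R -> X * unitI R, continuous r &
    [/\ forall x, r (x, zero) = (x, zero),
        forall b t, r (pfw_sec X b, t) = (pfw_sec X b, t),
        forall z, fw_proj (r z).1 = fw_proj z.1 &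
        forall z, uval (r z).2 <= 0 \/ range (fw_sec X) (r z).1].
Proof.
case=> hep _.
pose M := [set z : X * unitI R | uval z.2 <= 0 \/ range (fw_sec X) z.1].
have Mp_cts : continuous (fun z : set_type M => fw_proj (set_val z).1) by cts.
pose Y := FwSpace Mp_cts.
have f_mem (x : X) : M (x, zero) by left; rewrite /= val_zero.
have H_mem (z : B * unitI R) : M (pfw_sec X z.1, z.2) by right; exists z.1.
pose f x : Y := exist (fun z => z \in M) _ (mem_set (f_mem x)).
pose H z : Y := exist (fun z => z \in M) _ (mem_set (H_mem z)).
have f_cts : continuous f.
  by apply: cts_sub; exact: (cts_pair (@cts_id X) (@cts_cst _ _ zero)).
have H_cts : continuous (H : B * unitI R -> Y).
  by apply: cts_sub; change (continuous (fun z : B * unitI R => (pfw_sec X z.1, z.2))); cts.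
have Hp (z : fw_cyl R (fw_base B)) : fw_proj (H z) = fw_proj z by exact: pfw_secK.
have [|K [K0 K1]] := hep Y (@FwMap B X Y f f_cts (fun=> erefl))
  (@FwMap B (fw_cyl R (fw_base B)) Y H H_cts Hp).
  by move=> b; apply: val_inj.
have cK : continuous (K : X * unitI R -> Y) by exact: (fw_fun_cts K).
exists (fun z => set_val (K z)); first exact: (cts_val cK).
split=> [x|b t|z|z]; last exact: (set_valP (K z)).
- by rewrite K0.
- by rewrite (K1 b t).
- exact: (fw_fun_proj K z).
Qed.

Section Extension.
Variables (X : pfwSpace B) (Z Y : topologicalType) (r : Z -> X * unitI R).
Hypothesis X_closed : closed (range (fw_sec X)).
Hypothesis r_cts : continuous r.
Hypothesis r_target : forall z, uval (r z).2 <= 0 \/ range (fw_sec X) (r z).1.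
Variables (F G : Z -> Y).
Hypotheses (F_cts : continuous F) (G_cts : continuous G).
Hypothesis FG : forall z, (r z).2 = zero -> range (fw_sec X) (r z).1 -> F z = G z.

(** [F] applies where [r] lands in the bottom of the cylinder, and [G] where it
    lands over the section.  Both are defined everywhere, and that the section
    is closed makes the result continuous. *)
Definition extend z : Y := if uval (r z).2 <= 0 then F z else G z.

Lemma extend_cts : continuous extend.
Proof.
have c1 := cts_fst r_cts; have c2 := cts_uval (cts_snd r_cts).
apply: (@cts_paste _ _ [set z | uval (r z).2 <= 0]
  [set z | range (fw_sec X) (r z).1] F G) => //.
- exact: closed_le0.
- by apply: closed_comp => // z _; exact: c1.
- by move=> z /= h; rewrite /extend h.
- move=> z /= h; rewrite /extend; case: ifP => // r0.
  by apply: FG => //; rewrite -[_.2]clampK clamp0.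
Qed.

End Extension.

(** The inclusion of the second factor of the fibrewise product. *)
Definition sec_pair X (y : X) : fwprod X X :=
  prod_mk (@pfw_secK B X (fw_proj y) : fw_proj (pfw_sec X (fw_proj y)) = fw_proj y).

Lemma sec_pair_cts X : continuous (@sec_pair X).
Proof. by apply: prod_mk_cts; cts. Qed.

Lemma sec_pair_proj X (y : X) : fw_proj (sec_pair y) = fw_proj y.
Proof. exact: pfw_secK. Qed.

(** Retract the first factor and keep the second. *)
Lemma sec_pair_cofibration X : fw_well_pointed R X ->
  fw_cofibration R (@FwMap B X (fwprod X X) _ (@sec_pair_cts X) (@sec_pair_proj X)).
Proof.
move=> wX Y f H Hf; have [r cr [r0 rs rp rt]] := well_pointed_retraction wX.
have [_ clX] := wX.
have c1 := @prod_fst_cts B X; have c2 := @prod_snd_cts B X.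
pose P := (fwprod X X * unitI R)%type.
pose rz (z : P) := r (prod_fst z.1, z.2).
have crz : continuous rz by rewrite /rz; cts.
have mem (z : P) : fw_proj (rz z).1 = fw_proj (prod_snd z.1) by rewrite rp /= prod_eq.
pose F (z : P) : Y := f (prod_mk (mem z)).
pose G (z : P) : Y := H (prod_snd z.1, (rz z).2).
have cF : continuous F.
  by apply: (cts_comp (fw_fun_cts f)); apply: prod_mk_cts; cts.
have cG : continuous G by apply: (cts_comp (fw_fun_cts H)); cts.
have FG z : (rz z).2 = zero -> range (fw_sec X) (rz z).1 -> F z = G z.
  move=> z0 /sec_range zs; rewrite /F /G z0 Hf /=; congr (f _); apply: prod_inj => //.
  by rewrite /prod_fst /= zs mem.
have cK := extend_cts clX crz (fun z => rt _) cF cG FG.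
have Kp (z : fw_cyl R (fwprod X X)) : fw_proj (extend rz F G z) = fw_proj z.
  rewrite /extend; case: ifP => _; first by rewrite /F fw_fun_proj; exact: rp.
  by rewrite /G fw_fun_proj; exact: esym (prod_eq z.1).
exists (@FwMap B (fw_cyl R (fwprod X X)) Y _ cK Kp); split => [z|y t].
  rewrite /= /extend /rz r0 /= val_zero lexx /F; congr (f _).
  by apply: prod_inj => //; rewrite /prod_fst /= /rz r0.
have rzE : rz (sec_pair y, t) = (pfw_sec X (fw_proj y), t) by exact: rs.
have GE : G (sec_pair y, t) = H (y, t) by rewrite /G rzE.
change (extend rz F G (sec_pair y, t) = H (y, t)).
rewrite /extend; case: ifP => [t0|//]; rewrite -GE; apply: FG.
  by rewrite -[_.2]clampK clamp0.
by rewrite rzE; exists (fw_proj y).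
Qed.

(** The section of the product is [sec_pair] after the section of [X]. *)
Lemma well_pointed_fwprod X : fw_well_pointed R X -> fw_well_pointed R (fwprod X X).
Proof.
move=> wX; have [hep clX] := wX; split; last first.
  have c1 := @prod_fst_cts B X; have c2 := @prod_snd_cts B X.
  have -> : range (fw_sec (fwprod X X)) =
      (@prod_fst B X @^-1` range (fw_sec X)) `&` (@prod_snd B X @^-1` range (fw_sec X)).
    apply/seteqP; split => [z [b _ <-]|z [/sec_range z1 /sec_range z2]].
      by split; exists b.
    exists (fw_proj z) => //; apply: prod_inj; first by rewrite [RHS]z1.
    by rewrite [RHS]z2 -prod_eq.
  by apply: closedI; apply: closed_comp.
move=> Y f H Hf.
pose u := @FwMap B X (fwprod X X) _ (@sec_pair_cts X) (@sec_pair_proj X).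
have us b : u (pfw_sec X b) = pfw_sec (fwprod X X) b.
  by apply: prod_inj; rewrite /prod_fst /= ?pfw_secK.
have [|K [K0 K1]] := hep Y (fw_comp f u) H; first by
  move=> b; rewrite Hf; congr (f _); exact: esym (us b).
have [|L [L0 L1]] := sec_pair_cofibration wX (f := f) (H := K).
  by move=> y; rewrite K0.
exists L; split => // b t; rewrite -K1 -L1.
by congr (L (_, t)); exact: esym (us b).
Qed.

(** Dual to [palindrome_vertical]: the contraction of the path along the section
    is extended instead of lifted, and the extension is followed along the
    three other sides of the square. *)
Lemma palindrome_pointed X Y (M : X * unitI R -> Y) : fw_well_pointed R X ->
  continuous M -> (forall x t, fw_proj (M (x, t)) = fw_proj x) ->
  (forall b t, M (pfw_sec X b, clamp (1 - uval t)) = M (pfw_sec X b, t)) ->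
  (forall b, M (pfw_sec X b, zero) = pfw_sec Y b) ->
  exists D : X * unitI R -> Y,
    [/\ continuous D, forall x t, fw_proj (D (x, t)) = fw_proj x,
        forall x, D (x, zero) = M (x, zero), forall x, D (x, one) = M (x, one) &
        forall b t, D (pfw_sec X b, t) = pfw_sec Y b].
Proof.
move=> wX cM pM Msym Ms; have [r cr [r0 rs rp rt]] := well_pointed_retraction wX.
have [_ clX] := wX.
pose M' (z : B * unitI R) := M (pfw_sec X z.1, z.2).
have cM' : continuous M' by rewrite /M'; cts.
pose N := @retrace R Y Y id B M'.
have cN : continuous N by apply: cts_retrace => //; exact: cts_id.
pose P := ((X * unitI R) * unitI R)%type.
pose rz (z : P) := r (z.1.1, z.2).
have crz : continuous rz by rewrite /rz; cts.
pose F (z : P) := M ((rz z).1, z.1.2).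
pose G (z : P) := N ((fw_proj z.1.1, z.1.2), (rz z).2).
have cF : continuous F by rewrite /F; cts.
have cG : continuous G by rewrite /G; cts.
have N0 b t : N ((b, t), zero) = M (pfw_sec X b, t).
  by rewrite /N retrace0 //= => b' t'; rewrite /M' Msym.
have FG z : (rz z).2 = zero -> range (fw_sec X) (rz z).1 -> F z = G z.
  by move=> z0 /sec_range zs; rewrite /F /G z0 N0 zs rp.
have cK := extend_cts clX crz (fun z => rt _) cF cG FG.
pose K := extend rz F G.
have K0 z : K (z, zero) = M z.
  by rewrite /K /extend /F /rz r0 /= val_zero lexx -surjective_pairing.
have Ksec b t s : K ((pfw_sec X b, t), s) = N ((b, t), s).
  rewrite /K /extend /F /G /rz /= rs /= pfw_secK; case: ifP => // s0.
  by have -> : s = zero; [rewrite -[s]clampK clamp0|rewrite N0].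
have Kp x t s : fw_proj (K ((x, t), s)) = fw_proj x.
  rewrite /K /extend /F /G /rz /=; case: ifP => _; first by rewrite pM rp.
  by rewrite /N /retrace /M' pM pfw_secK.
pose L (z : X * unitI R) := K ((z.1, zero), z.2).
pose T (z : X * unitI R) := K ((z.1, z.2), one).
pose E (z : X * unitI R) := K ((z.1, one), z.2).
have cL : continuous L by rewrite /L; cts.
have cT : continuous T by rewrite /T; cts.
have cE : continuous E by rewrite /E; cts.
exists (hcat (hcat L T) (hrev E)); split.
- apply: cts_hcat; first by apply: cts_hcat.
    exact: cts_hrev.
  by move=> z; rewrite hcat1 hrev0.
- move=> x; apply: (hcatP (P := fun y => fw_proj y = fw_proj x)).
    by apply: (hcatP (P := fun y => fw_proj y = fw_proj x)) => t; exact: Kp.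
  by move=> t; exact: Kp.
- by move=> x; rewrite !hcat0 /L K0.
- by move=> x; rewrite hcat1 hrev1 /E K0.
- move=> b; have end0 t := (@retrace_end R Y Y id B M' b t).
  apply: (hcatP (P := fun y => y = pfw_sec Y b)).
    apply: (hcatP (P := fun y => y = pfw_sec Y b)) => t.
      by rewrite /L Ksec /N; have [-> _] := end0 t; exact: Ms.
    by rewrite /T Ksec /N retrace1; exact: Ms.
  by move=> t; rewrite /hrev /E Ksec /N; have [_ ->] := end0 (clamp (1 - uval t)); exact: Ms.
Qed.

(** Extend the track of the homotopy along the section to a homotopy of the
    identity, and let [k] be its end.  Following this extension backwards and
    then the given homotopy leads from [k h] to the identity, forth and back
    along the section. *)
Lemma pointed_left_inverse X (h : pfwMap X X) : fw_well_pointed R X ->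
  fw_homotopic R h (fw_id X) ->
  exists k : pfwMap X X, pfw_homotopic R (pfw_comp k h) (pfw_id X).
Proof.
move=> wX /fwhE[phi [cphi pphi phi0 phi1]]; have [hep _] := wX.
have H_cts : continuous (fun z : B * unitI R => phi (pfw_sec X z.1, z.2)) by cts.
have Hp (z : fw_cyl R (fw_base B)) : fw_proj (phi (pfw_sec X z.1, z.2)) = fw_proj z.
  by rewrite pphi pfw_secK.
have [|psi [psi0 psis]] := hep X (fw_id X) (@FwMap B (fw_cyl R (fw_base B)) X _ H_cts Hp).
  by move=> b; rewrite /= phi0 pfw_fun_sec.
have cpsi : continuous (psi : X * unitI R -> X) by exact: (fw_fun_cts psi).
have ppsi x t : fw_proj (psi (x, t)) = fw_proj x by exact: (fw_fun_proj psi (x, t)).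
have psiS b t : psi (pfw_sec X b, t) = phi (pfw_sec X b, t) by exact: (psis b t).
have k_cts : continuous (fun x => psi (x, one)).
  by apply: (cts_comp cpsi); cts.
have k_sec b : FwMap k_cts (fun x => ppsi x one) (pfw_sec X b) = pfw_sec X b.
  by rewrite /= psiS phi1.
exists (PfwMap k_sec).
pose Q (z : X * unitI R) := psi (h z.1, z.2).
have cQ : continuous Q by apply: (cts_comp cpsi); cts.
pose M := hcat (hrev Q) phi.
have [|x t|b t|b|D [cD pD D0 D1 Ds]] := @palindrome_pointed X X M wX.
- apply: cts_hcat => //; first exact: cts_hrev.
  by move=> x; rewrite hrev1 /Q psi0 phi0.
- move: x t; move=> x; apply: (hcatP (P := fun y => fw_proj y = fw_proj x)) => t.
    by rewrite /hrev /Q ppsi /= fw_fun_proj.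
  exact: pphi.
- have ? := unitI_ge0 t; have ? := unitI_le1 t.
  rewrite /M /hcat /hrev /Q /= pfw_fun_sec !psiS clamp_id; [|lra..].
  case: (ltrgtP (2 * uval t - 1) 0) => ht.
  + rewrite ifF; last by apply/negbTE; rewrite -ltNge; lra.
    by rewrite clamp_id; [congr (phi (_, clamp _))|..]; lra.
  + rewrite ifT; last by lra.
    by rewrite clamp_id; [congr (phi (_, clamp _))|..]; lra.
  + rewrite ifT; last by lra.
    by congr (phi (_, clamp (1 - uval (clamp _)))); lra.
- by rewrite /M hcat0 hrev0 /Q pfw_fun_sec psiS phi1.
apply: (@pfwhI R B X X _ _ D) => //.
- by move=> x; rewrite D0 /M hcat0 hrev0.
- by move=> x; rewrite D1 /M hcat1 phi1.
Qed.

(** An inverse of [f] is moved to a pointed one by extending the track of the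
    homotopy along the section; then the previous lemma applies. *)
Lemma pointed_left_inverse_fhe X Y (f : pfwMap X Y) :
  fw_well_pointed R X -> fw_well_pointed R Y -> fw_homotopy_equiv R f ->
  exists l : pfwMap Y X, pfw_homotopic R (pfw_comp l f) (pfw_id X).
Proof.
move=> wX [hep _] [g [gf _]]; have [L [cL pL L0 L1]] := fwhE gf.
have H_cts : continuous (fun z : B * unitI R => L (pfw_sec X z.1, z.2)) by cts.
have Hp (z : fw_cyl R (fw_base B)) : fw_proj (L (pfw_sec X z.1, z.2)) = fw_proj z.
  by rewrite pL pfw_secK.
have [|G [G0 Gs]] := hep X g (@FwMap B (fw_cyl R (fw_base B)) X _ H_cts Hp).
  by move=> b; rewrite /= L0 /= pfw_fun_sec.
have cG : continuous (G : Y * unitI R -> X) by exact: (fw_fun_cts G).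
have pG x t : fw_proj (G (x, t)) = fw_proj x by exact: (fw_fun_proj G (x, t)).
have g1_cts : continuous (fun x => G (x, one)) by apply: (cts_comp cG); cts.
have g1_sec b : FwMap g1_cts (fun x => pG x one) (pfw_sec Y b) = pfw_sec X b.
  by rewrite /= (Gs b one) /= L1.
pose g1 : pfwMap Y X := PfwMap g1_sec.
have gg1 : fw_homotopic R g1 g by apply: fwh_sym; apply: (@fwhI R B Y X g g1 G).
have [|k kg] := @pointed_left_inverse X (pfw_comp g1 f) wX.
  apply: (fwh_trans _ gf); exact: (fwh_compr f gg1).
by exists (pfw_comp k g1); apply: (pfwh_trans _ kg); exact: pfwh_refl.
Qed.

(** A pointed left inverse of [f] is again a free equivalence, hence has a pointed
    left inverse in turn, and so is a two-sided one. *)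
Theorem pointed_fhe X Y (f : pfwMap X Y) :
  fw_well_pointed R X -> fw_well_pointed R Y -> fw_homotopy_equiv R f ->
  pfw_homotopy_equiv R f.
Proof.
move=> wX wY ff; have [l lf] := pointed_left_inverse_fhe wX wY ff.
have l_fhe : fw_homotopy_equiv R l.
  apply: (fhe_cancel_r ff); apply: (fhe_homotopic (fwh_sym (pfwh_fwh lf))).
  exact: (@fhe_iso R B X X (fw_id X) (fw_id X)).
have [m ml] := pointed_left_inverse_fhe wY wX l_fhe.
exists l; split => //; apply: (pfwh_trans _ ml).
apply: (@pfwh_trans R B _ _ (pfw_comp (pfw_comp m l) (pfw_comp f l))).
  apply: pfwh_sym; apply: (pfwh_trans (pfwh_compr (pfw_comp f l) ml)).
  exact: pfwh_refl.
apply: (@pfwh_trans R B _ _ (pfw_comp m (pfw_comp (pfw_comp l f) l))).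
  exact: pfwh_refl.
apply: pfwh_compl; apply: (pfwh_trans (pfwh_compr l lf)); exact: pfwh_refl.
Qed.

End WellPointed.

(** * Shearing and division *)

Lemma pfwh_pair (R : realType) (B : topologicalType) (X Y Z : pfwSpace B)
    (f f' : pfwMap Z X) (g g' : pfwMap Z Y) :
  pfw_homotopic R f f' -> pfw_homotopic R g g' ->
  pfw_homotopic R (pfw_pair f g) (pfw_pair f' g').
Proof.
case/pfwhE => h [ch ph h0 h1 hs] /pfwhE[k [ck pk k0 k1 ks]].
have mem (z : Z * unitI R) : @fwprod_set B X Y (h z, k z).
  by case: z => z t; rewrite /fwprod_set /= ph pk.
pose H z : fwprod X Y := exist (fun z => z \in @fwprod_set B X Y) _ (mem_set (mem z)).
apply: (@pfwhI R B Z (fwprod X Y) _ _ H).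
- by apply: cts_sub; exact: cts_pair.
- by move=> z t; exact: ph.
- by move=> z; apply: val_inj; rewrite /= h0 k0.
- by move=> z; apply: val_inj; rewrite /= h1 k1.
- by move=> b t; apply: val_inj; rewrite /= hs ks.
Qed.

(** The second component of an inverse of the shearing map is a division. *)
Lemma shearing_division (R : realType) (B : topologicalType) (X : pfwSpace B)
    (mu : pfwMap (fwprod X X) X) :
  pfw_homotopy_equiv R (fw_shearing mu) ->
  exists delta : pfwMap (fwprod X X) X, fw_division R mu delta.
Proof.
case=> g [_ shg]; exists (pfw_comp (pr2 X X) g); rewrite /fw_division.
have pr1g : pfw_homotopic R (pr1 X X) (pfw_comp (pr1 X X) g).
  apply: pfwh_sym; apply: (pfwh_trans _ (pfwh_trans (pfwh_compl (pr1 X X) shg) _)).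
    exact: pfwh_refl.
  exact: pfwh_refl.
have prg := pfwh_pair pr1g (pfwh_refl (f := pfw_comp (pr2 X X) g) R (fun=> erefl)).
apply: (pfwh_trans (pfwh_compl mu prg)).
apply: (pfwh_trans _ (pfwh_trans (pfwh_compl (pr2 X X) shg) _)); last exact: pfwh_refl.
apply: pfwh_refl => z /=; congr (mu _); apply: val_inj => /=.
by rewrite -surjective_pairing.
Qed.


Theorem proposition5p7 (R : realType) (B : topologicalType) (X : pfwSpace B)
    (mu : pfwMap (fwprod X X) X)
    (mu_Hspace : fw_Hspace R mu)
    (X_well_pointed : fw_well_pointed R X)
    (B_path_connected : path_connected R B)
    (B_numerably_categorical : numerably_categorical R B)
    (X_weakly_fibrant : weakly_fibrant R X)
    (X_fibre : exists b : B,
       connected [set: fibre X b] /\ CW_complex R (fibre X b)) :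
  pfw_homotopy_equiv R (fw_shearing mu) /\
  exists delta : pfwMap (fwprod X X) X, fw_division R mu delta.
Proof.
have sh_equiv : pfw_homotopy_equiv R (fw_shearing mu).
  have [b [b_connected b_cw]] := X_fibre.
  have wP := well_pointed_fwprod X_well_pointed.
  have fP := weakly_fibrant_fwprod X_weakly_fibrant.
  apply: (pointed_fhe wP wP).
  apply: (dold_categorical B_path_connected B_numerably_categorical fP fP).
  exact: (shearing_fibre_fhe mu_Hspace b_connected b_cw).
by split => //; exact: shearing_division.
Qed.
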